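(* For any index $\mathbf{k}$, \[ Z_{q}^{\mathcal{S}, \ast}(g_{\overline{\mathbf{k}}})=(-1)^{\mathrm{wt}(\mathbf{k})}Z_{q}^{\mathcal{S}, \ast}(g_{\mathbf{k}}), \] and \[ Z_{q}^{\mathcal{S}, \mathrm{sh}}(E_{\overline{\mathbf{k}}})\equiv (-1)^{\mathrm{wt}(\mathbf{k})}Z_{q}^{\mathcal{S}, \mathrm{sh}}(E_{\mathbf{k}}) \] modulo $(1-q)\mathcal{Z}_{q}$. Consequently, $\zeta_{q}^{\mathcal{S}}(\overline{\mathbf{k}})=(-1)^{\mathrm{wt}(\mathbf{k})}\zeta_{q}^{\mathcal{S}}(\mathbf{k})$ for every index $\mathbf{k}$.
   Context: Indices: an index is a finite (possibly empty) tuple $\mathbf k=(k_1,\dots,k_r)$ of positive integers, weight $\mathrm{wt}(\mathbf k)=k_1+\cdots+k_r$, reversal $\overline{\mathbf k}=(k_r,\dots,k_1)$; admissible if empty or $k_r\ge2$. Let $\mathcal{C}=\mathbb{Q}[\hbar]$ ($\hbar$ formal), $\mathfrak{H}=\mathcal{C}\langle a,b\rangle$ (non-commutative polynomials). For $k\ge1$ put $g_k=ba^k$, $e_k=b(a+\hbar)a^{k-1}$. Let $A=\{\hbar b\}\cup\{ba^k\mid k\ge1\}$, $\mathcal{C}\langle A\rangle$ the $\mathcal{C}$-subalgebra generated by $1$ and $A$, $\mathfrak z$ the $\mathcal C$-span of $A$, $\widehat{\mathfrak H^0}=\mathcal C+\sum_{k\ge1}\mathcal C\langle A\rangle g_k$.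 Fix $q\in\mathbb{C}$, $0<|q|<1$; $\mathbb{C}$ is a $\mathcal{C}$-module with $\hbar$ acting by $1-q$; $[m]=(1-q^m)/(1-q)$; $F_q(m;\cdot):\mathfrak{z}\to\mathbb{C}$ is $\mathcal{C}$-linear with $F_q(m;\hbar b)=1-q$, $F_q(m;g_k)=q^{km}/[m]^k$; $Z_{q,M}:\mathcal{C}\langle A\rangle\to\mathbb{C}$ is $\mathcal{C}$-linear with $Z_{q,M}(1)=1$, $Z_{q,M}(u_1\cdots u_r)=\sum_{0<m_1<\cdots<m_r<M}\prod_i F_q(m_i;u_i)$ ($u_i\in A$); $Z_q(w)=\lim_{M\to\infty}Z_{q,M}(w)$ for $w\in\widehat{\mathfrak H^0}$. Harmonic product: $\circ_\hbar$ symmetric $\mathcal C$-bilinear on $\mathfrak z$ with $(\hbar b)\circ_\hbar(\hbar b)=\hbar\cdot\hbar b$, $(\hbar b)\circ_\hbar g_k=\hbar g_k$, $g_k\circ_\hbar g_l=g_{k+l}$; $\ast_\hbar$ on $\mathcal{C}\langle A\rangle$: $w\ast_\hbar1=1\ast_\hbar w=w$, $(wu)\ast_\hbar(w'v)=(w\ast_\hbar w'v)u+(wu\ast_\hbar w')v+(w\ast_\hbar w')(u\circ_\hbar v)$ ($u,v\in A$). Shuffle product $\mathrm{sh}_\hbar$ on $\mathfrak H$: $w\,\mathrm{sh}_\hbar\,1=1\,\mathrm{sh}_\hbar\,w=w$, $wa\,\mathrm{sh}_\hbar\,w'a=(wa\,\mathrm{sh}_\hbar\,w'+w\,\mathrm{sh}_\hbar\,w'a+\hbar(w\,\mathrm{sh}_\hbar\,w'))a$,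 $wb\,\mathrm{sh}_\hbar\,w'=w\,\mathrm{sh}_\hbar\,w'b=(w\,\mathrm{sh}_\hbar\,w')b$. $\psi^\ast,\psi^{\mathrm{sh}}$: $\mathcal C$-algebra anti-involutions of $\mathcal C\langle A\rangle$ with $\psi^\ast(\hbar b)=\psi^{\mathrm{sh}}(\hbar b)=\hbar b$, $\psi^\ast(ba^k)=b(-a)^k$, $\psi^{\mathrm{sh}}(ba^k)=b(-a-\hbar)^k$. For $\bullet\in\{\ast,\mathrm{sh}\}$: $w^{\mathcal S,\bullet}_\hbar(1)=1$, $w^{\mathcal S,\bullet}_\hbar(u_1\cdots u_r)=\sum_{i=0}^r(u_1\cdots u_i)\bullet_\hbar\psi^\bullet(u_{i+1}\cdots u_r)$ ($u_j\in A$), $\mathcal C$-linear; $Z^{\mathcal S,\bullet}_{q,M}=Z_{q,M}\circ w^{\mathcal S,\bullet}_\hbar$. $g_{\mathbf k}=g_{k_1}\cdots g_{k_r}$, $g_\varnothing=1$. $E_{1^m}=\frac1{(m+1)!}\sum_{j=0}^m g_1^{\mathrm{sh}_\hbar j}\,\mathrm{sh}_\hbar\,e_1^{\mathrm{sh}_\hbar(m-j)}$ ($m\ge0$); for $\mathbf k=(1^{s_0},t_1+2,1^{s_1},\dots,t_r+2,1^{s_r})$ (unique form, $1^s$ = $s$ ones), $E_{\mathbf k}=E_{1^{s_0}}e_{t_1+2}E_{1^{s_1}}\cdots e_{t_r+2}E_{1^{s_r}}$, $E_\varnothing=1$. $Z_q^{\mathcal S,\ast}(g_{\mathbf k})=\lim_{M\to\infty}Z^{\mathcal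 S,\ast}_{q,M}(g_{\mathbf k})$ and $Z_q^{\mathcal S,\mathrm{sh}}(E_{\mathbf k})=\lim_{M\to\infty}Z^{\mathcal S,\mathrm{sh}}_{q,M}(E_{\mathbf k})$ (the limits exist). Let $\mathfrak n_0$ be the $\mathcal C$-span of $(\hbar b)^{\alpha_1}g_{\beta_1+1}\cdots(\hbar b)^{\alpha_r}g_{\beta_r+1}$ with $r\ge1$, $\alpha_i,\beta_i\ge0$ and $\alpha_s\ge1,\beta_t\ge1$ for some $1\le s\le t\le r$; $\mathfrak n=\mathfrak n_0+\hbar\widehat{\mathfrak H^0}$; $\mathfrak H^0=\mathcal C+\sum_{k\ge2}\mathcal C\langle A\rangle g_k+\mathfrak n$; $\mathcal Z_q=Z_q(\mathfrak H^0)$, $\mathcal N_q=Z_q(\mathfrak n)$, $\mathcal P_q$ the ideal of $\mathcal Z_q$ generated by $\{Z_q(g_{2k})\mid k\ge1\}$. The $q$-analogue of the symmetric multiple zeta value is $\zeta_q^{\mathcal S}(\mathbf k)=$ the class of $Z_q^{\mathcal S,\ast}(g_{\mathbf k})$ in $\mathcal Z_q/(\mathcal N_q+\mathcal P_q)$ (which equals the class of $Z_q^{\mathcal S,\mathrm{sh}}(E_{\mathbf k})$). *)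

(* Defs.v *)
From mathcomp Require Import all_boot all_algebra.
From mathcomp Require Import complex.
From mathcomp Require Import all_classical all_reals all_analysis.
Import GRing.Theory Num.Theory numFieldNormedType.Exports.

Set Implicit Arguments.
Unset Strict Implicit.
Unset Printing Implicit Defensive.

Local Open Scope ring_scope.
Local Open Scope classical_set_scope.

(* The algebra  H = C<a,b>,  C = Q[hbar].                                    *)
(* Elements of H are represented by FORMAL finite sums  sum_i c_i w_i        *)
(* (lists of (coefficient, word)).  All maps below are defined termwise      *)
(* (i.e. C-linearly), so their values (in particular the values of Z_{q,M})  *)
(* only depend on the element of H represented.                              *)

Definition coef := {poly rat}.
Definition hbar : coef := 'X.
Definition word := seq bool.
Definition la : bool := true.
Definition lb : bool := false.
Definition elt := seq (coef * word).

Definition e0 : elt := [::].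
Definition e1 : elt := [:: (1, [::])].
Definition eword (w : word) : elt := [:: (1, w)].
Definition eadd (x y : elt) : elt := x ++ y.
Definition escale (c : coef) (x : elt) : elt := [seq (c * t.1, t.2) | t <- x].
Definition eopp (x : elt) : elt := escale (-1) x.
Definition emul (x y : elt) : elt := [seq (t.1 * s.1, t.2 ++ s.2) | t <- x, s <- y].

Definition bak (k : nat) : word := lb :: nseq k la.
(* a "letter word" s = [k_1;...;k_r] stands for  b a^{k_1} ... b a^{k_r}.
   (b a^0 = b; in C<A> the letter b only occurs as  hbar b.)                   *)
Definition lword (s : seq nat) : word := flatten (map bak s).

(* g_k = b a^k,  e_k = b (a + hbar) a^{k-1} = b a^k + hbar b a^{k-1} *)
Definition g_ (k : nat) : elt := eword (bak k).
Definition e_ (k : nat) : elt := [:: (1, bak k); (hbar, bak k.-1)].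
Definition g_idx (k : seq nat) : elt := eword (lword k).

Fixpoint to_letters (w : word) : option (seq nat) :=
  match w with
  | [::] => Some [::]
  | x :: w' =>
      if x == la then None
      else let n := find (fun y => y == lb) w' in
           if all (fun y => y == la) (take n w') then
             match to_letters (drop n w') with
             | Some s => Some (n :: s)
             | None => None
             end
           else None
  end.

(* shuffle product sh_hbar on words, computed on REVERSED words
   (head of the list = last letter):
     wb sh w' = (w sh w') b,  w sh w'b = (w sh w') b,
     wa sh w'a = (wa sh w' + w sh w'a + hbar (w sh w')) a.                   *)
Definition app_last (l : bool) (x : elt) : elt := [seq (t.1, l :: t.2) | t <- x].

Fixpoint sh_rev (u : word) : word -> elt :=
  match u with
  | [::] => fun v => [:: (1, v)]
  | x :: u' =>
      fix sh_in (v : word) : elt :=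
        match v with
        | [::] => [:: (1, x :: u')]
        | y :: v' =>
            if x == lb then app_last lb (sh_rev u' (y :: v'))
            else if y == lb then app_last lb (sh_in v')
            else app_last la (sh_in v' ++ sh_rev u' (y :: v')
                              ++ escale hbar (sh_rev u' v'))
        end
  end.

Definition sh_word (u v : word) : elt :=
  [seq (t.1, rev t.2) | t <- sh_rev (rev u) (rev v)].

Definition esh (x y : elt) : elt :=
  flatten [seq escale (t.1 * s.1) (sh_word t.2 s.2) | t <- x, s <- y].

Definition shpow (x : elt) (n : nat) : elt := iter n (esh x) e1.

(* harmonic product *_hbar on C<A>, on letter words (reversed):
   (wu)*(w'v) = (w * w'v) u + (wu * w') v + (w * w') (u o v),
   with  (b a^k) o (b a^l) = b a^(k+l)  (this encodes  (hbar b)o(hbar b) = hbar.hbar b,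
   (hbar b) o g_k = hbar g_k,  g_k o g_l = g_(k+l)).                           *)
Definition lelt := seq (coef * seq nat).
Definition lapp_last (k : nat) (x : lelt) : lelt := [seq (t.1, k :: t.2) | t <- x].

Fixpoint st_rev (u : seq nat) : seq nat -> lelt :=
  match u with
  | [::] => fun v => [:: (1, v)]
  | k :: u' =>
      fix st_in (v : seq nat) : lelt :=
        match v with
        | [::] => [:: (1, k :: u')]
        | l :: v' =>
            lapp_last k (st_rev u' (l :: v')) ++ lapp_last l (st_in v')
            ++ lapp_last (k + l) (st_rev u' v')
        end
  end.

Definition to_elt (x : lelt) : elt := [seq (t.1, lword t.2) | t <- x].

Definition st_letters (s t : seq nat) : elt :=
  to_elt [seq (p.1, rev p.2) | p <- st_rev (rev s) (rev t)].

(* The anti-involutions psi^* and psi^sh on letters b a^k:                   *)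
(*  psi^*(b a^k) = b (-a)^k = (-1)^k b a^k,                                  *)
(*  psi^sh(b a^k) = b(-a-hbar)^k = (-1)^k sum_j binom(k,j) hbar^(k-j) b a^j.   *)
Definition sgn (k : nat) : coef := (-1) ^+ k.

Definition psi_ast (s : seq nat) : elt :=
  [:: (\prod_(k <- s) sgn k, lword (rev s))].

Definition psi_sh_letter (k : nat) : elt :=
  [seq (sgn k * ('C(k, j))%:R * hbar ^+ (k - j), bak j) | j <- iota 0 k.+1].

Definition psi_sh (s : seq nat) : elt :=
  foldr (fun k acc => emul acc (psi_sh_letter k)) e1 s.

(* w^{S,*}(u_1...u_r) = sum_i (u_1..u_i) *_hbar psi^*(u_{i+1}..u_r), and
   psi^*(...) is a single (signed) letter word. *)
Definition wS_ast_letters (s : seq nat) : elt :=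
  flatten [seq escale (\prod_(k <- drop i s) sgn k)
                      (st_letters (take i s) (rev (drop i s)))
          | i <- iota 0 (size s).+1].

Definition wS_sh_letters (s : seq nat) : elt :=
  flatten [seq esh (eword (lword (take i s))) (psi_sh (drop i s))
          | i <- iota 0 (size s).+1].

(* C-linear extension to (the C-span of words starting with b, containing) C<A> *)
Definition wS_ast (x : elt) : elt :=
  flatten [seq match to_letters t.2 with
               | Some s => escale t.1 (wS_ast_letters s)
               | None => e0 end | t <- x].

Definition wS_sh (x : elt) : elt :=
  flatten [seq match to_letters t.2 with
               | Some s => escale t.1 (wS_sh_letters s)
               | None => e0 end | t <- x].

Definition E_ones (m : nat) : elt :=
  escale ((m.+1)`!%:R^-1)%:P
    (flatten [seq esh (shpow (g_ 1) j) (shpow (e_ 1) (m - j)) | j <- iota 0 m.+1]).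

(* k = (1^{s0}, t1+2, 1^{s1}, ..., tr+2, 1^{sr}) |-> E_{1^{s0}} e_{t1+2} E_{1^{s1}} ... *)
Fixpoint E_aux (n : nat) (k : seq nat) : elt :=
  match k with
  | [::] => E_ones n
  | x :: k' => if x == 1%N then E_aux n.+1 k'
               else emul (E_ones n) (emul (e_ x) (E_aux 0 k'))
  end.
Definition E_idx (k : seq nat) : elt := E_aux 0 k.

Section Zq.
Variable R : realType.
Local Notation C := R[i].
Variable q : C.

Definition ev (c : coef) : C := (map_poly (ratr : rat -> C) c).[1 - q].
Definition qint (m : nat) : C := (1 - q ^+ m) / (1 - q).
(* F_q(m; b a^k) = q^{km}/[m]^k for k >= 1; the letter b (k = 0) only occurs
   inside C<A> as hbar b, and F_q(m; hbar b) = 1 - q = ev hbar * 1.           *)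
Definition Fq (m k : nat) : C := q ^+ (k * m) / qint m ^+ k.

(* sum_{0 < m_1 < ... < m_r < M} prod_i F(m_i; k_i), on the reversed word *)
Fixpoint Zrev (rs : seq nat) (M : nat) : C :=
  match rs with
  | [::] => 1
  | k :: rs' => \sum_(1 <= m < M) Fq m k * Zrev rs' m
  end.

Definition ZqM (M : nat) (x : elt) : C :=
  \sum_(t <- x) match to_letters t.2 with
                | Some s => ev t.1 * Zrev (rev s) M
                | None => 0
                end.

Definition cvgC (u : nat -> C) (l : C) : Prop :=
  ((fun n => complex.Re (u n)) @ \oo --> complex.Re l) /\
  ((fun n => complex.Im (u n)) @ \oo --> complex.Im l).
Definition limC (u : nat -> C) : C :=
  Complex (limn (fun n => complex.Re (u n))) (limn (fun n => complex.Im (u n))).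

Definition Zq (x : elt) : C := limC (fun M => ZqM M x).

Definition ZqS_ast (x : elt) : C := Zq (wS_ast x).
Definition ZqS_sh (x : elt) : C := Zq (wS_sh x).

Definition cspan (G : set elt) : set elt :=
  [set x | exists l : seq (coef * elt),
      (forall p, p \in l -> G p.2) /\ x = flatten [seq escale p.1 p.2 | p <- l]].

(* a word in A, written as a letter word s: the element (hbar b)-letters
   contribute a factor hbar each *)
Definition Aword (s : seq nat) : elt := [:: (hbar ^+ count (pred1 0%N) s, lword s)].

(* generators of C<A> g_k, k >= kmin:  u_1 ... u_r g_k  (u_i in A) *)
Definition gen_Ag (kmin : nat) : set elt :=
  [set x | exists s k, (kmin <= k)%N /\ x = Aword (rcons s k)].

Definition gen_H0hat : set elt := [set e1] `|` gen_Ag 1.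

(* n_0 : (hbar b)^{al_1} g_{be_1+1} ... (hbar b)^{al_r} g_{be_r+1}, r >= 1,
   with al_s >= 1, be_t >= 1 for some 1 <= s <= t <= r. *)
Definition gen_n0 : set elt :=
  [set x | exists (al be : seq nat) (s t : nat),
      size al = size be /\ (0 < size al)%N /\ (s <= t < size al)%N /\
      (1 <= nth 0 al s)%N /\ (1 <= nth 0 be t)%N /\
      x = Aword (flatten [seq rcons (nseq p.1 0%N) p.2.+1 | p <- zip al be])].

Definition gen_n : set elt := gen_n0 `|` [set escale hbar y | y in gen_H0hat].

Definition gen_H0 : set elt := [set e1] `|` gen_Ag 2 `|` gen_n.

Definition Zset_q : set C := Zq @` cspan gen_H0.
Definition Nset_q : set C := Zq @` cspan gen_n.
Definition Pset_q : set C :=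
  [set z | exists l : seq (C * nat),
      (forall p, p \in l -> Zset_q p.1 /\ (1 <= p.2)%N) /\
      z = \sum_(p <- l) p.1 * Zq (g_ (2 * p.2))].

End Zq.

Definition wt (k : seq nat) : nat := sumn k.

(* Main.v *)
Require Import Defs.
From HB Require Import structures.
From mathcomp Require Import all_boot all_order all_algebra.
From mathcomp Require Import complex.
From mathcomp Require Import all_classical all_reals all_analysis.
From mathcomp Require Import ring lra.
Import Order.TTheory GRing.Theory Num.Theory numFieldNormedType.Exports.
Set Implicit Arguments.
Unset Strict Implicit.
Unset Printing Implicit Defensive.
Local Open Scope ring_scope.
Local Open Scope classical_set_scope.

(* The star part holds for every truncation M: Z_{q,M} is multiplicative for the harmonic
   product, so Z_{q,M}(w^{S,*}(g_k)) is a sum over the cuts of k that is symmetric up to sign.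

   For the shuffle part, (H, sh_hbar) is a commutative ring in which P(w) = wa is a Rota-Baxter
   operator of weight hbar and wb = b.w.  There the generating series of the E_{1^m} x^m is
   G = (1 - beta a)^-1 gamma with beta = (exp(hbar x b) - 1) / hbar = x b gamma, and for all
   V, V' the signed sum of (V u) sh (V' psi(v)) over the cuts (u, v) of G collapses to
   F(x) sh F'(-x), where F = V (1 - beta a)^-1 solves F = V + P(beta F), and F' likewise.
   If V and V' end with the letter a (or V' = 1), Rota-Baxter writes this product as P(w)
   with w in C<A>, which lies in H^0.  Finally, psi^sh maps the block
   e_t = P^(t-1) (P + hbar) b to (-1)^t P (P + hbar)^(t-1) b, which is (-1)^t e_t modulo
   hbar H^0, and this is the only discrepancy between w^{S,sh} of E_k and of its reversal. *)

(** * The shuffle algebra as a ring of formal series in words *)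

(** Formal sums represent elements only up to regrouping, so the algebra is done on coefficient
    functions, where equality is genuine and [ring] applies; [emb] leads from one to the other, and
    [ZqM] only depends on the image.

    The factor 1/(m+1)! in E_(1^m) belongs to a divided difference: since e_1 = g_1 + hbar b, the
    sum in E_(1^m) is (e_1^(m+1) - g_1^(m+1)) / (hbar b) with shuffle powers, whence G = gamma exp(x
    g_1). The shift a -> -a - hbar in psi^sh is compensated by exp(-hbar x b), the inverse of 1 +
    hbar beta. Hence psi^sh(E_(1^n)) = (-1)^n E_(1^n) exactly, and runs of ones cause no error.

    Two obstacles shape the rest. The error must be hbar times an element of H^0, so one factor hbar
    per bare letter b has to be tracked through all shuffle products. And the limit can be split
    only where the truncated sums converge, which requires every nonempty word to end with a. *)

(* A possibly infinite sum of words, given by its coefficients; as in sh_rev, the head of a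
   word is its last letter.  The coefficients of the shuffle product at a word only involve
   words that are not longer, so shm below is defined by recursion on the word alone. *)
Definition hseries : Type := word -> coef.

HB.instance Definition _ := GRing.Zmodule.copy hseries (word -> coef).

Definition hscale (c : coef) (f : hseries) : hseries := fun w => c * f w.

Lemma hscaleA a b v : hscale a (hscale b v) = hscale (a * b) v.
Proof. by apply/funext => w; rewrite /hscale mulrA. Qed.
Lemma hscale1 : left_id 1 hscale.
Proof. by move=> v; apply/funext => w; rewrite /hscale mul1r. Qed.
Lemma hscaleDr : right_distributive hscale +%R.
Proof. by move=> a u v; apply/funext => w; apply: mulrDr. Qed.
Lemma hscaleDl v : {morph hscale^~ v : a b / a + b}.
Proof. by move=> a b; apply/funext => w; apply: mulrDl. Qed.

HB.instance Definition _ := GRing.Zmodule_isLmodule.Build coef hseries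
  hscaleA hscale1 hscaleDr hscaleDl.

Definition der (x : bool) (f : hseries) : hseries := fun w => f (x :: w).
Definition nob (f : hseries) : hseries :=
  fun w => if w is false :: _ then 0 else f w.

(** A product ends with b as soon as one factor does, hence [nob] at a final a. At a final b that
    letter is taken from [f] first, and [nob f] keeps pairs that both end with b from being counted
    twice. *)
Fixpoint shm (w : word) (f g : hseries) : coef :=
  match w with
  | [::] => f [::] * g [::]
  | true :: w' => shm w' (der true f) (nob g) + shm w' (nob f) (der true g)
                  + hbar * shm w' (der true f) (der true g)
  | false :: w' => shm w' (der false f) g + shm w' (nob f) (der false g)
  end.

Definition shmul (f g : hseries) : hseries := fun w => shm w f g.
Definition sh1 : hseries := fun w => if w is [::] then 1 else 0.
Definition Pop (f : hseries) : hseries := fun w => if w is true :: w' then f w' else 0.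
Definition Bop (f : hseries) : hseries := fun w => if w is false :: w' then f w' else 0.

Lemma hsD (f g : hseries) w : (f + g) w = f w + g w. Proof. by []. Qed.
Lemma hsZ (c : coef) (f : hseries) w : (c *: f) w = c * f w. Proof. by []. Qed.

Lemma derD x (f g : hseries) : der x (f + g) = der x f + der x g. Proof. by []. Qed.
Lemma nobD (f g : hseries) : nob (f + g) = nob f + nob g.
Proof. by apply/funext => -[|[] w] //=; rewrite hsD /= addr0. Qed.
Lemma derZ x (c : coef) (f : hseries) : der x (c *: f) = c *: der x f. Proof. by []. Qed.
Lemma nobZ (c : coef) (f : hseries) : nob (c *: f) = c *: nob f.
Proof. by apply/funext => -[|[] w] //=; rewrite hsZ /= mulr0. Qed.
Lemma nobE (f : hseries) : f = nob f + Bop (der false f).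
Proof. by apply/funext => -[|[] w]; rewrite hsD /= ?addr0 ?add0r. Qed.
Lemma nob_id (f : hseries) : nob (nob f) = nob f.
Proof. by apply/funext => -[|[] w]. Qed.
Lemma derb_nob (f : hseries) : der false (nob f) = 0. Proof. by []. Qed.
Lemma nobB (f : hseries) : nob (Bop f) = 0.
Proof. by apply/funext => -[|[] w]. Qed.

Lemma derB (f : hseries) : der true (Bop f) = 0. Proof. by []. Qed.

Lemma shmDl w f f' g : shm w (f + f') g = shm w f g + shm w f' g.
Proof.
elim: w f f' g => [|[] w IH] f f' g /=; first by rewrite hsD mulrDl.
  rewrite !derD !nobD !IH; ring.
rewrite !derD !nobD !IH; ring.
Qed.
Lemma shmDr w f g g' : shm w f (g + g') = shm w f g + shm w f g'.
Proof.
elim: w f g g' => [|[] w IH] f g g' /=; first by rewrite hsD mulrDr.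
  rewrite !derD !nobD !IH; ring.
rewrite !derD !IH; ring.
Qed.
Lemma shmZl w (c : coef) (f g : hseries) : shm w (c *: f) g = c * shm w f g.
Proof.
elim: w f g => [|[] w IH] f g /=; first by rewrite hsZ mulrA.
  rewrite !derZ !nobZ !IH; ring.
rewrite !derZ !nobZ !IH; ring.
Qed.
Lemma shm0l w g : shm w 0 g = 0.
Proof. by have := shmZl w 0 0 g; rewrite scaler0 mul0r. Qed.

Lemma der0 x : der x 0 = 0. Proof. by []. Qed.
Lemma nob0 : nob 0 = 0. Proof. by apply/funext => -[|[]]. Qed.
Lemma shm0r w f : shm w f 0 = 0.
Proof.
elim: w f => [|[] w IH] f /=; first by rewrite mulr0.
  by rewrite nob0 !der0 !IH mulr0 !addr0.
by rewrite der0 !IH addr0.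
Qed.

Lemma shmul_Bl f g : shmul (Bop f) g = Bop (shmul f g).
Proof.
apply/funext => -[|[] w]; rewrite /shmul /=; first by rewrite mul0r.
  by rewrite nobB derB !shm0l mulr0 !addr0.
by rewrite nobB shm0l addr0.
Qed.

Lemma shmul_Br f g : shmul f (Bop g) = Bop (shmul f g).
Proof.
suff H w : shm w f (Bop g) = Bop (shmul f g) w by apply/funext => w; apply: H.
elim: w f g => [|[] w IH] f g /=; first by rewrite mulr0.
  by rewrite nobB derB !shm0r mulr0 !addr0.
rewrite IH -[Bop _ w]/((Bop (shmul (der false f) g)) w) -shmul_Bl /shmul.
by rewrite -shmDl addrC -nobE.
Qed.

Lemma shmulDl : left_distributive shmul +%R.
Proof. by move=> f f' g; apply/funext => w; apply: shmDl. Qed.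
Lemma shmulC : commutative shmul.
Proof.
suff H w f g : shm w f g = shm w g f by move=> f g; apply/funext => w; apply: H.
elim: w f g => [|[] w IH] f g /=; first by rewrite mulrC.
  rewrite (IH (der true f) (nob g)) (IH (nob f)) (IH (der true f) (der true g)).
  by rewrite (addrC (shm _ _ _)).
(* The rule at a final b favours the left factor. Splitting off the words of the other factor that
   end with b makes it symmetric, up to one product under [Bop] that the induction hypothesis covers
   too. *)
have split u v : shm w u v = shm w u (nob v) + Bop (shmul u (der false v)) w.
  by rewrite -shmul_Br -shmDr -nobE.
rewrite (split (der false f)) (split (der false g)) (IH (nob f)) (IH (nob g)).
have -> : Bop (shmul (der false f) (der false g)) w = Bop (shmul (der false g) (der false f)) w.
  by rewrite -shmul_Bl -shmul_Br; apply: IH.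
by rewrite -addrA addrC (addrC (Bop _ w)).
Qed.

Lemma der_true_shm f g : der true (shmul f g) =
  shmul (der true f) (nob g) + shmul (nob f) (der true g)
  + hbar *: shmul (der true f) (der true g).
Proof. by []. Qed.
Lemma der_false_shm f g : der false (shmul f g) =
  shmul (der false f) g + shmul (nob f) (der false g).
Proof. by []. Qed.
Lemma nob_shm f g : nob (shmul f g) = shmul (nob f) (nob g).
Proof.
apply/funext => -[|[] w] //=; rewrite /shmul /= ?nob_id //.
by rewrite !derb_nob shm0l shm0r addr0.
Qed.

Lemma shmulA : associative shmul.
Proof.
suff H w f g h : shm w f (shmul g h) = shm w (shmul f g) h.
  by move=> f g h; apply/funext => w; apply: H.
have Zr w' c f' g' : shm w' f' (c *: g') = c * shm w' f' g'.
  have E : shmul f' (c *: g') w' = shmul (c *: g') f' w' by rewrite shmulC.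
  by rewrite -/(shmul _ _ w') E /shmul shmZl -/(shmul g' f' w') shmulC.
elim: w f g h => [|[] w IH] f g h /=; first by rewrite /shmul /= mulrA.
  rewrite !der_true_shm !nob_shm !(shmDl, shmDr, shmZl, Zr) !IH; ring.
rewrite !der_false_shm !nob_shm !(shmDl, shmDr) !IH; ring.
Qed.

Lemma sh1mul : left_id sh1 shmul.
Proof.
move=> f; apply/funext => w; rewrite /shmul.
have n1 : nob sh1 = sh1 by apply/funext => -[|[]].
have d1 x : der x sh1 = 0 by [].
suff H : (shm w sh1 f = f w) by [].
elim: w f => [|[] w IH] f /=; first by rewrite mul1r.
  by rewrite n1 !d1 !shm0l IH mulr0 add0r addr0.
by rewrite n1 !d1 !shm0l IH add0r.
Qed.
Lemma sh1_neq0 : sh1 != 0.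
Proof. by apply/eqP => /(congr1 (fun f : hseries => f [::])) /eqP; rewrite /= oner_eq0. Qed.

HB.instance Definition _ := GRing.Zmodule_isComNzRing.Build hseries
  shmulA shmulC sh1mul shmulDl sh1_neq0.

Lemma shscaleAl (c : coef) (f g : hseries) : c *: (f * g) = (c *: f) * g.
Proof. by apply/funext => w; rewrite hsZ; symmetry; apply: shmZl. Qed.

HB.instance Definition _ := GRing.Lmodule_isLalgebra.Build coef hseries shscaleAl.
HB.instance Definition _ := GRing.Lalgebra_isComAlgebra.Build coef hseries.

Definition bb : hseries := Bop 1.
Definition hh : hseries := hbar%:A.

Lemma Bop_mul f : Bop f = bb * f.
Proof. by rewrite -{1}(mul1r f); symmetry; apply: shmul_Bl. Qed.

Lemma hhE (f : hseries) : hbar *: f = hh * f.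
Proof. by rewrite mulr_algl. Qed.

Lemma Pop_linear : linear Pop.
Proof. by move=> c f g; apply/funext => -[|[] w] //=; rewrite hsD hsZ /= mulr0 addr0. Qed.
HB.instance Definition _ := GRing.isLinear.Build coef hseries hseries *:%R Pop Pop_linear.

Lemma nobP f : nob (Pop f) = Pop f.
Proof. by apply/funext => -[|[] w]. Qed.

Lemma rota_baxter (f g : hseries) :
  Pop f * Pop g = Pop (f * Pop g + Pop f * g + hh * (f * g)).
Proof.
apply/funext => -[|[] w].
- exact: mul0r.
- change (shm w (der true (Pop f)) (nob (Pop g)) + shm w (nob (Pop f)) (der true (Pop g))
     + hbar * shm w (der true (Pop f)) (der true (Pop g)) =
     (f * Pop g + Pop f * g + hh * (f * g)) w).
  by rewrite !nobP -hhE.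
- change (shm w 0 (Pop g) + shm w (nob (Pop f)) 0 = 0).
  by rewrite shm0l shm0r addr0.
Qed.

(** Appending b is injective on words, so hbar b is not a zero divisor. This stands in for the
    division by hbar b hidden in [gam]. *)
Lemma hbbI (f g : hseries) : hh * bb * f = hh * bb * g -> f = g.
Proof.
rewrite -!mulrA -!hhE -!Bop_mul => H; apply/funext => w.
have := congr1 (fun u : hseries => u (false :: w)) H; rewrite !hsZ /=.
by apply: mulfI; rewrite polyX_eq0.
Qed.

(** * Formal power series *)

Section PowerSeries.
Variable R : comNzRingType.

Definition pser : Type := nat -> R.
HB.instance Definition _ := GRing.Zmodule.copy pser (nat -> R).

Definition psmul (f g : pser) : pser := fun n => \sum_(i < n.+1) f i * g (n - i)%N.
Definition psC (c : R) : pser := fun n => if n is 0 then c else 0.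
Definition psX : pser := fun n => (n == 1)%:R.

(** The coefficient of x^n only sees truncations, so commutativity and associativity are inherited
    from polynomials. *)
Lemma coef_psmul (f g : pser) N n : (n < N)%N ->
  ((\poly_(i < N) f i) * (\poly_(i < N) g i))`_n = psmul f g n.
Proof.
move=> nN; rewrite coefM; apply: eq_bigr => i _; rewrite !coef_poly.
have iN : (i < N)%N by apply: leq_ltn_trans nN; rewrite -ltnS.
have niN : (n - i < N)%N by apply: leq_ltn_trans nN; apply: leq_subr.
by rewrite iN niN.
Qed.

Lemma psmulC : commutative psmul.
Proof. by move=> f g; apply/funext => n; rewrite -!(@coef_psmul _ _ n.+1) // mulrC. Qed.

Lemma psmulA : associative psmul.
Proof.
move=> f g h; apply/funext => n.
pose t (u : pser) := \poly_(i < n.+1) u i.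
have E u v w : psmul u (psmul v w) n = (t u * (t v * t w))`_n.
  rewrite coefM; apply: eq_bigr => i _; rewrite coef_poly ltn_ord.
  by rewrite coef_psmul // ltnS leq_subr.
by rewrite E mulrA mulrC -E psmulC.
Qed.

Lemma ps1mul : left_id (psC 1) psmul.
Proof.
move=> f; apply/funext => n; rewrite /psmul big_ord_recl /= mul1r subn0.
by rewrite big1 ?addr0 // => i _; rewrite mul0r.
Qed.

Lemma psmulDl : left_distributive psmul +%R.
Proof.
move=> f g h; apply/funext => n.
change ((psmul (f + g) h) n = psmul f h n + psmul g h n).
by rewrite /psmul -big_split; apply: eq_bigr => i _; apply: mulrDl.
Qed.

Lemma ps1_neq0 : psC 1 != 0.
Proof. by apply/eqP => /(congr1 (fun f : pser => f 0%N)) /eqP; rewrite /= oner_eq0. Qed.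

HB.instance Definition _ := GRing.Zmodule_isComNzRing.Build pser
  psmulA psmulC ps1mul psmulDl ps1_neq0.

Lemma psD (f g : pser) n : (f + g) n = f n + g n. Proof. by []. Qed.
Lemma psN (f : pser) n : (- f) n = - f n. Proof. by []. Qed.
Lemma psM (f g : pser) n : (f * g) n = \sum_(i < n.+1) f i * g (n - i)%N.
Proof. by []. Qed.

Lemma psCM c (f : pser) n : (psC c * f) n = c * f n.
Proof.
rewrite psM big_ord_recl subn0 /= big1 ?addr0 // => i _; exact: mul0r.
Qed.

Lemma psXM (f : pser) n : (psX * f) n = if n is m.+1 then f m else 0.
Proof.
case: n => [|n]; rewrite psM big_ord_recl [psX _]/psX /= mul0r add0r; first by rewrite big_ord0.
by rewrite big_ord_recl /psX mul1r big1 ?addr0 ?subn0 ?subSS ?subn0 // => i _; rewrite mul0r.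
Qed.

Lemma psCD : {morph psC : a b / a + b}.
Proof. by move=> a b; apply/funext => -[|n]; rewrite psD /= ?addr0. Qed.
Lemma psC_M : {morph psC : a b / a * b}.
Proof. by move=> a b; apply/funext => -[|n]; rewrite psCM //= mulr0. Qed.

Definition psflip (f : pser) : pser := fun n => (-1) ^+ n * f n.
Lemma psflipK f : psflip (psflip f) = f.
Proof. by apply/funext => n; rewrite /psflip mulrA -expr2 sqrr_sign mul1r. Qed.
Lemma psflipD : {morph psflip : f g / f + g}.
Proof. by move=> f g; apply/funext => n; rewrite /psflip !psD mulrDr. Qed.
Lemma psflipM : {morph psflip : f g / f * g}.
Proof.
move=> f g; apply/funext => n; rewrite /psflip !psM mulr_sumr; apply: eq_bigr => i _.
by rewrite mulrACA -exprD subnKC // -ltnS.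
Qed.
Lemma psflipC c : psflip (psC c) = psC c.
Proof. by apply/funext => -[|n]; rewrite /psflip /= ?mul1r ?mulr0. Qed.
Lemma psflip1 : psflip 1 = 1.
Proof. exact: psflipC. Qed.
Lemma psflipX : psflip psX = - psX.
Proof.
by apply/funext => -[|[|n]]; rewrite /psflip psN /psX /= ?mulr0 ?oppr0 // expr1 mulr1.
Qed.

End PowerSeries.
Arguments psX {R}.

(** [r] is contracting for the x-adic topology, so its affine fixed point is unique. *)
Lemma pser_unique (R : comNzRingType) (u : pser R) (r : pser R -> pser R) (f g : pser R) :
  (forall f g n, (forall m, (m < n)%N -> f m = g m) -> r f n = r g n) ->
  f = u + r f -> g = u + r g -> f = g.
Proof.
move=> Hr Hf Hg; apply/funext => n; elim/ltn_ind: n => n IH.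
by rewrite Hf Hg !psD (Hr f g n IH).
Qed.

Lemma sum_triangle (M : nmodType) (H : nat -> nat -> M) n :
  \sum_(j < n) \sum_(k < j.+1) H k (j - k)%N = \sum_(k < n) \sum_(i < n - k) H k i.
Proof.
elim: n => [|n IH]; first by rewrite !big_ord0.
rewrite big_ord_recr /= IH [in RHS]big_ord_recr /= subSnn big_ord1.
rewrite [X in _ + X]big_ord_recr /= subnn addrA -big_split /=; congr (_ + _).
by apply: eq_bigr => k _; rewrite subSn ?(ltnW (ltn_ord k)) // big_ord_recr.
Qed.

Lemma sum_triangleC (M : nmodType) (H : nat -> nat -> M) n :
  \sum_(k < n) \sum_(i < n - k) H k i = \sum_(k < n) \sum_(i < n - k) H i k.
Proof.
rewrite -(sum_triangle H) -(sum_triangle (fun i k => H k i)); apply: eq_bigr => j _.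
rewrite (reindex_inj rev_ord_inj) /=; apply: eq_bigr => i _.
by rewrite subSS subKn // -ltnS.
Qed.

(** * Exponential series *)

Section StrongRecursion.
Variables (T : Type) (d : T) (step : nat -> (nat -> T) -> T).

(** The later recursions call all smaller indices under a sum, which is not structural; a table of
    earlier values makes it so. The default [d] is only read at indices not yet computed. *)
Fixpoint srec_tab n : seq T :=
  if n is m.+1 then rcons (srec_tab m) (step m (nth d (srec_tab m))) else [::].
Definition srec n := step n (nth d (srec_tab n)).

Lemma srecE : (forall n f g, (forall m, (m < n)%N -> f m = g m) -> step n f = step n g) ->
  forall n, srec n = step n srec.
Proof.
move=> Hstep n; rewrite /srec; apply: Hstep.
have sz k : size (srec_tab k) = k by elim: k => //= k IH; rewrite size_rcons IH.
elim: n => // n IH m; rewrite ltnS /= nth_rcons sz leq_eqVlt => /orP[/eqP->|mn].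
  by rewrite ltnn eqxx.
by rewrite mn IH.
Qed.
End StrongRecursion.

Definition fct (n : nat) : coef := ((n`!)%:R^-1)%:P.

Lemma fct_bin n i : (i <= n)%N -> 'C(n, i)%:R * fct n = fct i * fct (n - i).
Proof.
move=> le; rewrite /fct -polyC_natr -!polyCM; congr (_%:P).
have /(congr1 (fun k : nat => k%:R : rat)) := bin_fact le.
have nz k : (k`!)%:R != 0 :> rat by rewrite pnatr_eq0 -lt0n fact_gt0.
have := (nz i, nz (n - i)%N, nz n).
rewrite !natrM => -[[h1 h2] h3] <-.
by field; rewrite h1 h2 /=; apply: contraNneq h3 => E; rewrite -(bin_fact le) !natrM E mul0r.
Qed.
Lemma fctS n : n.+1%:R * fct n.+1 = fct n.
Proof.
have := @fct_bin n.+1 n (leqnSn n); rewrite binSn subSnn => ->.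
by rewrite {2}/fct invr1 mulr1.
Qed.
Lemma fct0 : fct 0 = 1. Proof. by rewrite /fct invr1. Qed.

Definition hb : hseries := hh * bb.
(* The series eps = exp(hbar x b) and gam = (exp(hbar x b) - 1) / (hbar x b). *)
Definition expser (u : hseries) : pser hseries := fun n => fct n *: u ^+ n.
Definition eps : pser hseries := expser hb.
Definition gam : pser hseries := fun n => fct n.+1 *: hb ^+ n.

Lemma eps_gam : eps = 1 + psX * psC hb * gam.
Proof.
apply/funext => -[|n]; rewrite psD -mulrA psXM /= ?addr0 ?add0r ?psCM /eps /expser /gam.
  by rewrite fct0 scale1r.
by rewrite exprS scalerAr.
Qed.

Lemma expser_flip u : expser u * psflip (expser u) = 1.
Proof.
apply/funext => n; rewrite psM.
transitivity (fct n *: (- u + u) ^+ n).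
  rewrite exprDn scaler_sumr; apply: eq_bigr => i _; rewrite /psflip /expser.
  have le : (i <= n)%N by rewrite -ltnS.
  symmetry; transitivity (('C(n, i)%:R * fct n) *: (u ^+ i * ((-1) ^+ (n - i) * u ^+ (n - i)))).
    rewrite mulr_natl -scalerMnl scalerMnr (exprNn u) [u ^+ i * _]mulrC.
    by [].
  by rewrite fct_bin // -scalerAl -scalerAr -scalerAr scalerA.
rewrite addNr expr0n; case: n => [|n] /=; last by rewrite scaler0.
by rewrite fct0 scale1r.
Qed.

Lemma eps_flip : eps * psflip eps = 1. Proof. exact: expser_flip. Qed.

(** With t = hbar x b: (exp(t) - 1) exp(-t) / t = (exp(-t) - 1) / (-t). Multiply by t, then cancel x
    and hbar b. *)
Lemma gam_eps : gam * psflip eps = psflip gam.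
Proof.
have E := eps_gam; have E' := congr1 (@psflip _) E.
rewrite psflipD psflip1 !psflipM psflipX !psflipC in E'.
have H : psX * psC hb * (gam * psflip eps) = psX * psC hb * psflip gam.
  rewrite mulrA (_ : _ * gam = eps - 1); last by rewrite E addrC addKr.
  rewrite mulrBl mul1r eps_flip E'; ring.
apply/funext => n; have := congr1 (fun u : pser hseries => u n.+1) H.
by rewrite -!mulrA !psXM !psCM => /hbbI.
Qed.

Definition psP (f : pser hseries) : pser hseries := fun n => Pop (f n).
Lemma psPD f g : psP (f + g) = psP f + psP g.
Proof. by apply/funext => n; apply: raddfD. Qed.
Lemma psPN f : psP (- f) = - psP f.
Proof. by apply/funext => n; apply: raddfN. Qed.
Lemma psP_flip f : psP (psflip f) = psflip (psP f).
Proof.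
apply/funext => n; rewrite /psP /psflip -signr_odd; case: (odd n) => /=.
  by rewrite expr1 !mulN1r raddfN.
by rewrite expr0 !mul1r.
Qed.
Lemma psP_rota_baxter f g :
  psP f * psP g = psP (f * psP g + psP f * g + psC hh * (f * g)).
Proof.
apply/funext => n; rewrite psM {3}/psP !psD psCM !psM mulr_sumr -!big_split raddf_sum.
by apply: eq_bigr => i _; rewrite rota_baxter.
Qed.

(** * The equation F = V + P(beta F) *)

(** Expansion of V (1 - beta a)^-1 from the left: its first factor beta a is absorbed into V, so V
    varies along the recursion. *)
Definition fsol_step (n : nat) (F : nat -> hseries -> hseries) (V : hseries) : hseries :=
  (if n is 0 then V else 0) + \sum_(k < n) F (n - k.+1)%N (Pop (bb * gam k * V)).
Definition fsol : nat -> hseries -> hseries := locked (srec (fun=> 0) fsol_step).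

Lemma sub_ord_lt n (k : 'I_n) : (n - k.+1 < n)%N.
Proof. by case: n k => [[]//|n] k; rewrite subSS ltnS leq_subr. Qed.

Lemma fsolE n V : fsol n V =
  (if n is 0 then V else 0) + \sum_(k < n) fsol (n - k.+1)%N (Pop (bb * gam k * V)).
Proof.
rewrite /fsol -lock srecE //= => m f g fg; apply/funext => U; congr (_ + _).
by apply: eq_bigr => k _; rewrite fg // sub_ord_lt.
Qed.

(** With K the operator V -> P(beta V), the hypothesis reads U = c + U K, hence U = c (1 - K)^-1.
    Both the action of E_(1^n) and its sum of cuts are found in this way. *)
Lemma fsol_rec (U : nat -> hseries -> hseries) (c : nat -> hseries) :
  (forall n V, U n V = c n * V + \sum_(k < n) U (n - k.+1)%N (Pop (bb * gam k * V))) ->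
  forall n V, U n V = \sum_(i < n.+1) c i * fsol (n - i)%N V.
Proof.
move=> HU; elim/ltn_ind => n IH V; rewrite HU.
rewrite (eq_bigr (fun k : 'I_n => \sum_(i < (n - k.+1).+1)
   c i * fsol (n - k.+1 - i)%N (Pop (bb * gam k * V)))); last first.
  by move=> k _; rewrite IH // sub_ord_lt.
pose G i j k := c i * fsol j (Pop (bb * gam k * V)).
transitivity (c n * V + \sum_(k < n) \sum_(i < n - k) G i (n - i - k.+1)%N k).
  congr (_ + _); apply: eq_bigr => k _.
  rewrite subnSK //; apply: eq_bigr => i _.
  by rewrite /G subnAC.
rewrite (sum_triangleC (fun k i => G i (n - i - k.+1)%N k)) [in RHS]big_ord_recr /= addrC.
rewrite subnn fsolE big_ord0 addr0; congr (_ + _); apply: eq_bigr => i _.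
rewrite fsolE.
have : (0 < n - i)%N by rewrite subn_gt0.
by case E : (n - i)%N => [//|m] _; rewrite add0r mulr_sumr.
Qed.

(** K commutes with (1 - K)^-1, where K V = P(beta V). Unfolding both sides once more leaves a
    triangular double sum to transpose. *)
Lemma fsol_right n V : fsol n V =
  (if n is 0 then V else 0) + \sum_(k < n) Pop (bb * gam k * fsol (n - k.+1)%N V).
Proof.
elim/ltn_ind: n V => n IH V; rewrite fsolE; congr (_ + _).
case: n IH => [|n] IH; first by rewrite !big_ord0.
pose z (m : nat) (W : hseries) := if m is 0 then W else 0.
transitivity (\sum_(k < n.+1) (z (n - k)%N (Pop (bb * gam k * V)) +
   \sum_(i < n - k) Pop (bb * gam i * fsol (n - k - i.+1) (Pop (bb * gam k * V))))).
  by apply: eq_bigr => k _; rewrite subSS IH // ltnS leq_subr.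
transitivity (\sum_(k < n.+1) (z (n - k)%N (Pop (bb * gam k * V)) +
   \sum_(i < n - k) Pop (bb * gam k * fsol (n - k - i.+1) (Pop (bb * gam i * V))))); last first.
  apply: eq_bigr => k _; rewrite subSS [in RHS]fsolE mulrDr raddfD mulr_sumr raddf_sum /=.
  by congr (_ + _); case: (n - k)%N => //=; rewrite mulr0 raddf0.
rewrite !big_split /=; congr (_ + _).
rewrite !big_ord_recr /= !subnn !big_ord0 !addr0.
rewrite (sum_triangleC (fun k i => Pop (bb * gam i * fsol (n - k - i.+1) (Pop (bb * gam k * V))))).
by apply: eq_bigr => k _; apply: eq_bigr => i _; rewrite -!subnDA !addnS (addnC (nat_of_ord i)).
Qed.

Definition bet : pser hseries := psX * psC bb * gam.
Definition fsolp (V : hseries) : pser hseries := fun n => fsol n V.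

Lemma fsolp_eq V : fsolp V = psC V + psP (bet * fsolp V).
Proof.
apply/funext => n; rewrite psD {1}/fsolp fsol_right; congr (_ + _).
rewrite /psP /bet -!mulrA psXM; case: n => [|n]; first by rewrite big_ord0 raddf0.
rewrite psCM psM mulr_sumr raddf_sum; apply: eq_bigr => k _.
by rewrite mulrA subSS.
Qed.

Lemma bet_eps : 1 + psC hh * bet = eps.
Proof. by rewrite eps_gam /hb psC_M /bet; ring. Qed.

Lemma bet_flip : bet * psflip eps = - psflip bet.
Proof.
rewrite /bet -[LHS]mulrA gam_eps 2!psflipM psflipX psflipC; ring.
Qed.

Lemma fsolp_flip V : psflip (fsolp V) = psC V + psP (psflip bet * psflip (fsolp V)).
Proof. by rewrite {1}fsolp_eq psflipD psflipC -psflipM psP_flip. Qed.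

Lemma psPC c (f : pser hseries) : psP (psC (c%:A) * f) = psC (c%:A) * psP f.
Proof. by apply/funext => n; rewrite /psP !psCM !mulr_algl linearZ. Qed.

(* With u = v + bet F and w = v' + bet(-x) F'(-x), so that psP u = F and psP w = F'(-x) - c,
   the Rota-Baxter identity has no term in F F'(-x) because
   bet + bet(-x) + hbar bet bet(-x) = 0. *)
Lemma fsol_mul v c v' (V := Pop v) (V' := c%:A + Pop v') :
  fsolp V * psflip (fsolp V') =
  psP (psC v * (psflip (fsolp V') * psflip eps) + fsolp V * psC v' * eps + psC (hh * v * v')).
Proof.
set F := fsolp V; set F' := psflip (fsolp V').
pose u := psC v + bet * F; pose w := psC v' + psflip bet * F'.
have Fu : F = psP u by rewrite /F fsolp_eq psPD; congr (_ + _); apply/funext => -[|n] //=; rewrite /psP raddf0.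
have Fw : F' = psC c%:A + psP w.
  rewrite {1}/F' fsolp_flip /V' psCD -addrA; congr (_ + _); rewrite psPD; congr (_ + _).
  by apply/funext => -[|n] //=; rewrite /psP raddf0.
have E : F * psP w = psP (u * psP w + F * w + psC hh * (u * w)) by rewrite {1 2}Fu psP_rota_baxter -Fu.
(* The constant c is a scalar and passes through P, so only the product with psP w needs
   Rota-Baxter. *)
have -> : F * F' = psP (psC c%:A * u) + F * psP w by rewrite psPC -Fu {1}Fw; ring.
rewrite E -psPD; congr psP.
have -> : psP w = F' - psC c%:A by rewrite Fw addrC addKr.
have e1 := bet_eps.
have e2 : psflip eps = 1 + psC hh * psflip bet by rewrite -bet_eps psflipD psflip1 psflipM psflipC.
have e3 := bet_flip.
rewrite !psC_M /u /w.
have {}e3 : psflip bet = - bet * psflip eps by rewrite mulNr e3 opprK.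
have e4 : bet + psflip bet + psC hh * bet * psflip bet = 0.
  by rewrite {1}e3 e2; ring.
transitivity (psC v * (F' * psflip eps) + F * psC v' * eps + psC hh * psC v * psC v'
   + F * F' * (bet + psflip bet + psC hh * bet * psflip bet)).
  by rewrite e2 -e1; ring.
by rewrite e4 mulr0 addr0.
Qed.

(** * Sums over the cuts of a word *)

Definition leval (M : lmodType coef) (phi : seq nat -> M) (L : lelt) : M :=
  \sum_(t <- L) t.1 *: phi t.2.

Definition Qop (u : hseries) : hseries := Pop u + hh * u.
Definition lstep (k : nat) (V : hseries) : hseries := iter k Pop (bb * V).
Definition lact (V : hseries) (s : seq nat) : hseries := foldl (fun U k => lstep k U) V s.
Definition plstep (k : nat) (V : hseries) : hseries := (-1 : coef) ^+ k *: iter k Qop (bb * V).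
Definition pact (V : hseries) (s : seq nat) : hseries := foldr plstep V s.

(* lact V s and pact V s are V u and V psi^sh(u) for the word u of letters s; cuts V V' s
   is the sum of (V u) sh (V' psi^sh(v)) over the factorizations s = u v into letters. *)
Fixpoint cuts (V V' : hseries) (s : seq nat) : hseries :=
  if s is k :: s' then V * pact V' s + cuts (lstep k V) V' s' else V * V'.

Lemma Qop_linear : linear Qop.
Proof. by move=> c f g; rewrite /Qop linearP mulrDr -scalerAr scalerDr addrACA. Qed.
HB.instance Definition _ := GRing.isLinear.Build coef hseries hseries *:%R Qop Qop_linear.

Lemma lstep_linear k : linear (lstep k).
Proof.
rewrite /lstep => c f g; elim: k => [|k IH] /=; first by rewrite mulrDr scalerAr.
by rewrite IH linearP.
Qed.
HB.instance Definition _ k :=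
  GRing.isLinear.Build coef hseries hseries *:%R (lstep k) (lstep_linear k).

Lemma lact_linear s : linear (lact ^~ s).
Proof. by elim: s => //= k s IH c f g; rewrite lstep_linear IH. Qed.
Lemma plstep_linear k : linear (plstep k).
Proof.
have it : linear (fun V => iter k Qop (bb * V)).
  move=> c f g; elim: k => [|k IH] /=; first by rewrite mulrDr scalerAr.
  by rewrite IH linearP.
by rewrite /plstep => c f g; rewrite it scalerDr !scalerA mulrC.
Qed.
HB.instance Definition _ k :=
  GRing.isLinear.Build coef hseries hseries *:%R (plstep k) (plstep_linear k).

Lemma pact_linear s : linear (pact ^~ s).
Proof. by elim: s => //= k s IH c f g; rewrite IH plstep_linear. Qed.
Lemma cuts_linearl V' s : linear (fun V => cuts V V' s).
Proof.
elim: s => [|k s IH] c f g /=; first by rewrite mulrDl -scalerAl.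
by rewrite lstep_linear IH mulrDl -scalerAl scalerDr addrACA.
Qed.
Lemma cuts_linearr V s : linear (fun V' => cuts V V' s).
Proof.
elim: s V => [|k s IH] V c f g /=; first by rewrite mulrDr -scalerAr.
by rewrite IH (pact_linear s) plstep_linear mulrDr -scalerAr scalerDr addrACA.
Qed.

Lemma lact_cat V s s' : lact V (s ++ s') = lact (lact V s) s'.
Proof. exact: foldl_cat. Qed.
Lemma pact_cat V s s' : pact V (s ++ s') = pact (pact V s') s.
Proof. exact: foldr_cat. Qed.
(** The cut between [s] and [s'] occurs in both sums, hence the subtraction. *)
Lemma cuts_cat V V' s s' : cuts V V' (s ++ s') =
  cuts V (pact V' s') s + cuts (lact V s) V' s' - lact V s * pact V' s'.
Proof.
elim: s V => [|k s IH] V /=; first by rewrite addrAC subrr add0r.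
by rewrite IH pact_cat !addrA.
Qed.

Lemma linear0Z (M N : lmodType coef) (f : M -> N) : linear f ->
  f 0 = 0 /\ forall c v, f (c *: v) = c *: f v.
Proof.
move=> lf; have f0 : f 0 = 0 by have := lf (-1) 0 0; rewrite scaler0 add0r scaleN1r addNr.
by split=> // c v; have := lf c v 0; rewrite f0 !addr0.
Qed.

Lemma leval_linear (M N : lmodType coef) (f : M -> N) phi L : linear f ->
  f (leval phi L) = leval (f \o phi) L.
Proof.
move=> lf; have [f0 _] := linear0Z lf; rewrite /leval; elim: L => [|t L IH]; first by rewrite !big_nil.
by rewrite !big_cons lf IH.
Qed.

Lemma eq_leval (M : lmodType coef) (phi phi' : seq nat -> M) L : phi =1 phi' -> leval phi L = leval phi' L.
Proof. by move=> E; apply: eq_bigr => t _; rewrite E. Qed.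

Lemma levalZ (M : lmodType coef) (phi : seq nat -> M) c L :
  leval (fun s => c *: phi s) L = c *: leval phi L.
Proof. by rewrite scaler_sumr; apply: eq_bigr => t _; rewrite !scalerA mulrC. Qed.
Lemma levalD (M : lmodType coef) (phi psi : seq nat -> M) L :
  leval (fun s => phi s + psi s) L = leval phi L + leval psi L.
Proof. by rewrite -big_split; apply: eq_bigr => t _; rewrite scalerDr. Qed.

(* G = sum_n x^n E_(1^n) satisfies G = gam + bet a G; this is its coefficient of x^n. *)
Definition eones_step (n : nat) (X : nat -> lelt) : lelt :=
  (hbar ^+ n * fct n.+1, nseq n 0%N) ::
  flatten [seq [seq (hbar ^+ k * fct k.+1 * t.1, nseq k 0%N ++ 1%N :: t.2) | t <- X (n - k.+1)%N]
          | k <- iota 0 n].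
Definition eones : nat -> lelt := locked (srec [::] eones_step).

Lemma eonesE n : eones n = eones_step n eones.
Proof.
rewrite /eones -lock srecE // => m f g fg; congr (_ :: flatten _).
apply/eq_in_map => k; rewrite mem_iota /= add0n => km; rewrite fg //.
by case: m {fg} km => // m km; rewrite subSS ltnS leq_subr.
Qed.

Lemma leval_eones (M : lmodType coef) (phi : seq nat -> M) n : leval phi (eones n) =
  (hbar ^+ n * fct n.+1) *: phi (nseq n 0%N) +
  \sum_(k < n) (hbar ^+ k * fct k.+1) *:
     leval (fun s => phi (nseq k 0%N ++ 1%N :: s)) (eones (n - k.+1)%N).
Proof.
rewrite eonesE /leval big_cons /=; congr (_ + _).
rewrite big_flatten /= big_map -[X in iota 0 X]subn0 big_mkord; apply: eq_bigr => k _.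
by rewrite big_map scaler_sumr; apply: eq_bigr => t _; rewrite scalerA.
Qed.

Lemma gamE n : gam n = (hbar ^+ n * fct n.+1) *: bb ^+ n.
Proof.
by rewrite /gam /hb -hhE exprZn scalerA mulrC.
Qed.

Lemma lact_zeros V n : lact V (nseq n 0%N) = bb ^+ n * V.
Proof. by elim: n V => [|n IH] V /=; rewrite ?mul1r // IH exprSr mulrA. Qed.
Lemma pact_zeros V n : pact V (nseq n 0%N) = bb ^+ n * V.
Proof. by elim: n => [|n IH] /=; rewrite ?mul1r // IH /plstep expr0 scale1r exprS mulrA. Qed.

(** In V (1 - beta a)^-1 gamma the last factor involves only the letter b, so appending it is a
    shuffle multiplication. *)
Lemma lact_eones V n : leval (lact V) (eones n) = (gam * fsolp V) n.
Proof.
rewrite psM.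
pose U n V := leval (lact V) (eones n).
apply: (@fsol_rec U) => {}n {}V; rewrite /U leval_eones; congr (_ + _).
  by rewrite lact_zeros scalerAl -gamE.
apply: eq_bigr => k _; rewrite -levalZ; apply: eq_leval => s.
have [_ lZ] := linear0Z (lact_linear s).
rewrite lact_cat /= lact_zeros -lZ; congr (lact _ _).
by rewrite /lstep /= -linearZ gamE -scalerAr -scalerAl mulrA.
Qed.

Definition psQ (f : pser hseries) : pser hseries := fun n => Qop (f n).

Lemma psQE f : psQ f = psP f + psC hh * f.
Proof. by apply/funext => n; rewrite psD psCM. Qed.

Definition pactp (V : hseries) : pser hseries := fun n => leval (pact V) (eones n).

(** Apply psi^sh to G = gamma + beta a G: the order is reversed, so the leading run of b's comes
    last and [gam] factors out, while a becomes -(a + hbar), that is, -Q. *)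
Lemma pactp_eq V : pactp V = gam * (psC V - psX * psQ (psC bb * pactp V)).
Proof.
apply/funext => n; rewrite mulrBr psD psN [gam * psC V]mulrC psCM mulrCA.
rewrite {1}/pactp leval_eones pact_zeros scalerAl -gamE [V * _]mulrC; congr (_ + _).
rewrite psXM; case: n => [|n]; first by rewrite big_ord0 oppr0.
rewrite psM -sumrN; apply: eq_bigr => k _; rewrite subSS /psQ psCM.
rewrite gamE -scalerAl -scalerN; congr (_ *: _).
rewrite -[bb * _]/(lstep 0 _) (leval_linear _ _ (lstep_linear 0)) (leval_linear _ _ Qop_linear).
rewrite -mulrN /leval -sumrN mulr_sumr; apply: eq_bigr => t _.
rewrite pact_cat pact_zeros /= /plstep expr1 scaleN1r /= /lstep /=.
by rewrite mulrN -scalerN -mulrN scalerAr.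
Qed.

(** As bet(-x) = -x b gam(-x) and Q = P + hbar, the left side is V + P(bet(-x) F(-x)) + hbar bet(-x)
    F(-x). The first two terms add up to F(-x), and 1 + hbar bet(-x) = eps(-x). *)
Lemma pact_bracket V : psC V - psX * psQ (psC bb * psflip (gam * fsolp V)) =
  psflip eps * psflip (fsolp V).
Proof.
have E : psX * psC bb * psflip gam = - psflip bet.
  by rewrite /bet 2!psflipM psflipX psflipC; ring.
have e2 : psflip eps = 1 + psC hh * psflip bet.
  by rewrite -bet_eps psflipD psflip1 psflipM psflipC.
have QX f : psX * psQ f = psQ (psX * f).
  by apply/funext => -[|m]; rewrite /psQ !psXM ?linear0.
rewrite QX psflipM 2!mulrA E psQE mulNr psPN mulrN.
have F := fsolp_flip V.
rewrite e2 [in RHS]mulrDl mul1r {3}F; ring.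
Qed.

(** For V = 1 this is psi^sh(E_(1^n)) = (-1)^n E_(1^n): both sides solve the contracting equation
    [pactp_eq]. *)
Lemma pactp_fsol V : pactp V = psflip (gam * fsolp V).
Proof.
pose r f := - (gam * (psX * psQ (psC bb * f))).
apply: (@pser_unique _ (gam * psC V) r).
- move=> f g n fg; rewrite /r !psN mulrCA [in RHS]mulrCA !psXM.
  case: n fg => // n fg; congr (- _); rewrite !psM; apply: eq_bigr => k _.
  by rewrite /psQ !psCM fg // ltnS leq_subr.
- by rewrite {1}pactp_eq mulrBr.
by rewrite /r -mulrBr pact_bracket mulrA gam_eps psflipM.
Qed.

Lemma pact_eones V n : leval (pact V) (eones n) = (-1) ^+ n * (gam * fsolp V) n.
Proof. by rewrite -/(pactp V n) pactp_fsol. Qed.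

Lemma cuts_zeros V V' n : cuts V V' (nseq n 0%N) = n.+1%:R * (bb ^+ n * V * V').
Proof.
elim: n V => [|n IH] V /=; first by rewrite mul1r mul1r.
rewrite IH pact_zeros {1}/plstep expr0 scale1r /= /lstep /= !exprS -[n.+2]addn1 natrD; ring.
Qed.

(** The n+1 cuts that precede the letter ba all contribute the same, because b can be moved freely
    across a shuffle product. *)
Lemma cuts_block V V' n s : cuts V V' (nseq n 0%N ++ 1%N :: s) =
  n.+1%:R * (bb ^+ n * V * plstep 1 (pact V' s)) + cuts (Pop (bb ^+ n.+1 * V)) V' s.
Proof.
elim: n V => [|n IH] V; first by rewrite /= mul1r mul1r expr1.
rewrite [LHS]/= IH pact_cat pact_zeros [pact _ (1%N :: s)]/= {1}/plstep expr0 scale1r /=.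
have -> : bb ^+ n.+1 * lstep 0 V = bb ^+ n.+2 * V by rewrite [in RHS]exprSr mulrA.
rewrite /lstep /= addrA; congr (_ + _).
rewrite !exprS -[n.+2]addn1 natrD; ring.
Qed.

(** The n+1 equal cuts through a run of b's turn gam_n into (n+1) gam_n = eps_n. So the cuts up to
    the first letter ba give c = eps (V' - x Q(b V' psi(G))) = eps eps(-x) F'(-x) = F'(-x), and
    [fsol_rec] multiplies c by F. *)
Lemma cuts_eones V V' n :
  leval (cuts V V') (eones n) = (fsolp V * psflip (fsolp V')) n.
Proof.
pose U n V := leval (cuts V V') (eones n).
rewrite mulrC psM -/(U n V).
have epsE m : eps m = m.+1%:R * gam m by rewrite /eps /expser /gam -fctS !mulr_natl -scalerMnl.
have c_eq : psflip (fsolp V') = eps * (psC V' - psX * psQ (psC bb * pactp V')).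
  by rewrite pactp_fsol pact_bracket mulrA eps_flip mul1r.
apply: fsol_rec => {}n {}V; rewrite /U leval_eones.
rewrite c_eq mulrBr psD psN [eps * psC V']mulrC psCM mulrCA psXM.
rewrite cuts_zeros scalerAr scalerAl scalerAl -gamE.
have -> : n.+1%:R * (gam n * V * V') = V' * eps n * V by rewrite epsE; ring.
rewrite mulrDl -addrA; congr (_ + _).
case: n => [|n]; first by rewrite !big_ord0 oppr0 mul0r add0r.
rewrite psM mulNr mulr_suml -sumrN -big_split; apply: eq_bigr => k _ /=.
rewrite subSS /psQ psCM.
rewrite (eq_leval _ (cuts_block V V' k)) levalD scalerDr; congr (_ + _).
  pose g W := k.+1%:R * (bb ^+ k * V * plstep 1 W).
  have gl : linear g by move=> c f h; rewrite /g plstep_linear !mulrDr -!scalerAr.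
  rewrite -[leval _ _](leval_linear (pact V') _ gl) -/(pactp V' (n - k)%N) /g.
  rewrite scalerAr 2!scalerAl -gamE epsE /plstep expr1 scaleN1r /=; ring.
rewrite -levalZ; apply: eq_leval => s.
have [_ cZ] := linear0Z (cuts_linearl V' s).
by rewrite -cZ -linearZ gamE -scalerAr -scalerAl exprS.
Qed.

(** * From formal sums to series *)

Definition act (V : hseries) (w : word) : hseries :=
  foldl (fun U x => if x then Pop U else bb * U) V w.
Definition eact (V : hseries) (x : elt) : hseries := \sum_(t <- x) t.1 *: act V t.2.
Definition emb (x : elt) : hseries := eact 1 x.

Lemma act_cat V w w' : act V (w ++ w') = act (act V w) w'.
Proof. exact: foldl_cat. Qed.

Lemma act_linear w : linear (act ^~ w).
Proof.
elim: w => [|x w IH] c f g //=; rewrite -IH; congr (act _ w); case: x; first exact: linearP.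
by rewrite mulrDr scalerAr.
Qed.

Lemma act_lword V s : act V (lword s) = lact V s.
Proof.
elim: s V => // k s IH V; rewrite [lword _]/= act_cat IH; congr (lact _ s).
by rewrite /lstep /=; elim: k (bb * V) => //= k IHk U; rewrite IHk -iterSr.
Qed.

Lemma act1E w v : act 1 w v = (v == rev w)%:R.
Proof.
elim/last_ind: w v => [|w x IH] v; first by case: v.
rewrite -cats1 act_cat rev_cat /=; case: x => /=.
  by case: v => [|[] v] //=; rewrite IH eqseq_cons.
by rewrite -Bop_mul; case: v => [|[] v] //=; rewrite IH eqseq_cons.
Qed.

Lemma embE x v : emb x v = \sum_(t <- x) t.1 * (v == rev t.2)%:R.
Proof.
rewrite /emb /eact; elim: x => [|t x IH]; first by rewrite !big_nil.
by rewrite !big_cons hsD IH hsZ act1E.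
Qed.

(** Terms are collected by word. This is how maps defined termwise on lists, such as [ZqM] and
    [wS_sh], descend to elements of the algebra. *)
Lemma emb_functional (M : zmodType) (h : word -> coef -> M) x y :
  (forall w, {morph h w : a b / a + b}) -> emb x = emb y ->
  \sum_(t <- x) h t.2 t.1 = \sum_(t <- y) h t.2 t.1.
Proof.
move=> hD exy; have h0 w : h w 0 = 0 by apply: (addIr (h w 0)); rewrite -hD !add0r.
pose W := undup [seq t.2 | t <- x ++ y].
have key z : {subset [seq t.2 | t <- z] <= W} ->
    \sum_(t <- z) h t.2 t.1 = \sum_(w <- W) h w (emb z (rev w)).
  move=> zW; under [RHS]eq_bigr => w _ do
    rewrite embE (big_morph (h w) (hD w) (h0 w)).
  rewrite exchange_big /= !big_seq; apply: eq_bigr => t tz.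
  have tW : t.2 \in W by apply: zW; apply: map_f.
  rewrite (bigD1_seq t.2) ?undup_uniq //= eqxx mulr1 big1 ?addr0 // => w wt.
  by rewrite (inj_eq (can_inj revK)) (negbTE wt) mulr0.
rewrite !key ?exy // => w wz; rewrite mem_undup map_cat mem_cat wz ?orbT //.
Qed.

Lemma emb_cat x y : emb (x ++ y) = emb x + emb y.
Proof. exact: big_cat. Qed.
Lemma emb_scale c x : emb (escale c x) = c *: emb x.
Proof. by rewrite /emb /eact big_map scaler_sumr; apply: eq_bigr => t _; rewrite scalerA. Qed.
Lemma emb_flatten xs : emb (flatten xs) = \sum_(x <- xs) emb x.
Proof. exact: big_flatten. Qed.

Lemma emb_mul x y : emb (emul x y) = eact (emb x) y.
Proof.
rewrite /emb {1}/eact /emul big_allpairs_dep exchange_big; apply: eq_bigr => s _.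
have [f0 fZ] := linear0Z (act_linear s.2).
rewrite /eact (big_morph (act ^~ s.2) (_ : {morph act ^~ s.2 : u v / u + v}) f0); last first.
  by move=> u v; rewrite -[u in LHS]scale1r act_linear scale1r.
by rewrite scaler_sumr; apply: eq_bigr => t _; rewrite fZ scalerA act_cat mulrC.
Qed.

Lemma eq_emb_mul x x' y y' : emb x = emb x' -> emb y = emb y' ->
  emb (emul x y) = emb (emul x' y').
Proof.
move=> ex ey; rewrite !emb_mul ex; apply: (emb_functional (h := fun w c => c *: act _ w)) => //.
by move=> w a b; rewrite scalerDl.
Qed.

Lemma act1_rcons w x : act 1 (rcons w x) = if x then Pop (act 1 w) else bb * act 1 w.
Proof. by rewrite -cats1 act_cat. Qed.

Definition emb_rev (x : elt) : hseries := \sum_(t <- x) t.1 *: act 1 (rev t.2).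

Lemma emb_rev_app_last l x :
  emb_rev (app_last l x) = if l then Pop (emb_rev x) else bb * emb_rev x.
Proof.
rewrite /emb_rev big_map; case: l; rewrite ?raddf_sum ?mulr_sumr; apply: eq_bigr => t _ /=.
  by rewrite rev_cons act1_rcons linearZ.
by rewrite rev_cons act1_rcons scalerAr.
Qed.

Lemma emb_rev_sh u v : emb_rev (sh_rev u v) = act 1 (rev u) * act 1 (rev v).
Proof.
elim: u v => [|x u IHu] v /=; first by rewrite /emb_rev big_seq1 scale1r mul1r.
elim: v => [|y v IHv]; first by rewrite /emb_rev big_seq1 scale1r mulr1.
rewrite !rev_cons !act1_rcons.
case: x IHv => IHv /=; last first.
  by rewrite emb_rev_app_last IHu mulrA rev_cons act1_rcons.
case: y => /=; last by rewrite emb_rev_app_last IHv rev_cons act1_rcons mulrCA.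
rewrite emb_rev_app_last /emb_rev !big_cat /= -!/(emb_rev _) IHv IHu rota_baxter.
rewrite !rev_cons !act1_rcons; congr Pop.
rewrite {1}/emb_rev big_map; under eq_bigr => t _ do rewrite -scalerA.
rewrite -scaler_sumr -/(emb_rev _) IHu hhE addrA; congr (_ + _); exact: addrC.
Qed.

Lemma emb_sh x y : emb (esh x y) = emb x * emb y.
Proof.
have E z : emb z = \sum_(t <- z) t.1 *: act 1 t.2 by [].
rewrite /esh emb_flatten big_allpairs_dep /= (E x) (E y) mulr_suml; apply: eq_bigr => t _.
rewrite mulr_sumr; apply: eq_bigr => s _.
rewrite emb_scale -scalerAl -scalerAr scalerA; congr (_ *: _).
rewrite E /sh_word big_map.
by rewrite -[LHS]/(emb_rev _) emb_rev_sh !revK.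
Qed.

(** * The elements E_k *)

Section DividedDifference.
Variables (R : comNzRingType) (g y : R).

(** Division-free form of ((g + y)^(n+1) - g^(n+1)) / y. At g = g_1, y = hbar b it is the sum
    defining E_(1^n). *)
Definition divdiff (n : nat) : R := \sum_(j < n.+1) g ^+ j * (g + y) ^+ (n - j).

Lemma mul_divdiff n : y * divdiff n = (g + y) ^+ n.+1 - g ^+ n.+1.
Proof.
rewrite subrXX [g + y - g]addrC addKr; congr (_ * _).
by apply: eq_bigr => j _; rewrite mulrC.
Qed.

Lemma divdiffS n : divdiff n.+1 = (g + y) * divdiff n + g ^+ n.+1.
Proof.
rewrite /divdiff big_ord_recr /= subnn mulr1 mulr_sumr; congr (_ + _).
apply: eq_bigr => j _; have jn : (j <= n)%N by rewrite -ltnS.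
by rewrite subSn // exprS mulrCA.
Qed.

Lemma divdiffE n : divdiff n = \sum_(k < n.+1) 'C(n.+1, k.+1)%:R * (y ^+ k * g ^+ (n - k)).
Proof.
elim: n => [|n IH]; first by rewrite /divdiff !big_ord1 binn !expr0 !mul1r.
have -> : divdiff n.+1 = g * divdiff n + (g + y) ^+ n.+1.
  by rewrite divdiffS mulrDl mul_divdiff; ring.
rewrite exprDn IH mulr_sumr.
under [RHS]eq_bigr => k _ do rewrite binS natrD mulrDl.
rewrite big_split /=; congr (_ + _).
  rewrite [RHS]big_ord_recr /= bin_small // mul0r addr0; apply: eq_bigr => k _.
  have kn : (k <= n)%N by rewrite -ltnS.
  rewrite subSn // exprS; ring.
by apply: eq_bigr => k _; rewrite -mulr_natl [g ^+ _ * _]mulrC.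
Qed.
End DividedDifference.

Definition g1 : hseries := Pop bb.

(** By induction, Rota-Baxter applied to P(b) P(b D_n) gives P(b ((g_1 + hbar b) D_n + g_1^(n+1))),
    and the bracket is D_(n+1). *)
Lemma g1_exprS n : g1 ^+ n.+1 = Pop (bb * divdiff g1 hb n).
Proof.
elim: n => [|n IH]; first by rewrite /divdiff big_ord1 !mulr1.
rewrite exprS IH {1}/g1 rota_baxter -IH divdiffS /hb -/g1; congr Pop; ring.
Qed.

Lemma divdiff_fct n : fct n.+1 *: divdiff g1 hb n =
  \sum_(k < n.+1) gam k * (fct (n - k) *: g1 ^+ (n - k)).
Proof.
rewrite divdiffE scaler_sumr; apply: eq_bigr => k _.
have E : 'C(n.+1, k.+1)%:R * fct n.+1 = fct k.+1 * fct (n - k) by rewrite fct_bin // subSS.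
by rewrite /gam -scalerAl -scalerAr scalerA -E !mulr_natl -scalerMnl scalerMnr.
Qed.

(** So 1 (1 - beta a)^-1 is the shuffle exponential exp(x g_1), which links the explicit definition
    of E_(1^n) to the equation for F. *)
Lemma fsol1 n : fsol n 1 = fct n *: g1 ^+ n.
Proof.
elim/ltn_ind: n => -[|n] IH; rewrite fsol_right; first by rewrite big_ord0 addr0 fct0 scale1r.
rewrite add0r g1_exprS -linearZ scalerAr divdiff_fct mulr_sumr raddf_sum /=.
apply: eq_bigr => k _; rewrite subSS IH ?mulrA // ltnS; exact: leq_subr.
Qed.

Lemma fsol1_flip : fsolp 1 * psflip (fsolp 1) = 1.
Proof.
have -> : fsolp 1 = expser g1 by apply/funext => n; apply: fsol1.
exact: expser_flip.
Qed.

Lemma emb_to_elt L : emb (to_elt L) = leval (lact 1) L.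
Proof. by rewrite /emb /eact big_map; apply: eq_bigr => t _; rewrite act_lword. Qed.

Lemma emb_shpow x n : emb (shpow x n) = emb x ^+ n.
Proof.
elim: n => [|n IH]; first by rewrite /emb /eact big_seq1 scale1r.
by rewrite [shpow _ _]iterS emb_sh IH exprS.
Qed.

Lemma emb_E_ones m : emb (E_ones m) = emb (to_elt (eones m)).
Proof.
have eg : emb (g_ 1) = g1 by rewrite /emb /eact big_seq1 scale1r /= mulr1.
have ee : emb (e_ 1) = g1 + hb.
  by rewrite /emb /eact !big_cons big_nil addr0 scale1r hhE /= mulr1.
rewrite emb_to_elt lact_eones psM emb_scale emb_flatten big_map.
rewrite -[iota 0 m.+1]/(index_iota 0 m.+1) big_mkord -[LHS]/(fct m.+1 *: _).
under eq_bigr => j _ do rewrite emb_sh !emb_shpow eg ee.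
rewrite -/(divdiff g1 hb m) divdiff_fct; apply: eq_bigr => k _; by rewrite /fsolp fsol1.
Qed.

Definition lmul (L L' : lelt) : lelt := [seq (t.1 * s.1, t.2 ++ s.2) | t <- L, s <- L'].
Definition e_letters (x : nat) : lelt := [:: (1, [:: x]); (hbar, [:: x.-1])].
Fixpoint E_letters (n : nat) (k : seq nat) : lelt :=
  match k with
  | [::] => eones n
  | x :: k' => if x == 1%N then E_letters n.+1 k'
               else lmul (eones n) (lmul (e_letters x) (E_letters 0 k'))
  end.

Lemma lword_cat s s' : lword (s ++ s') = lword s ++ lword s'.
Proof. by rewrite /lword map_cat flatten_cat. Qed.

Lemma to_elt_lmul L L' : to_elt (lmul L L') = emul (to_elt L) (to_elt L').
Proof.
rewrite /to_elt /emul /lmul map_allpairs allpairs_mapl allpairs_mapr.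
by apply: eq_allpairs => t s /=; rewrite lword_cat.
Qed.

Lemma emb_E_idx n k : emb (E_aux n k) = emb (to_elt (E_letters n k)).
Proof.
elim: k n => [|x k IH] n /=; first exact: emb_E_ones.
case: eqP => // _; rewrite !to_elt_lmul.
apply: eq_emb_mul; first exact: emb_E_ones.
apply: eq_emb_mul => //; by rewrite /to_elt /= /lword /= !cats0.
Qed.

Lemma to_letters_lword s : to_letters (lword s) = Some s.
Proof.
elim: s => // k s IH.
have H : find (fun y => y == lb) (nseq k la ++ lword s) = k.
  rewrite find_cat has_nseq andbF size_nseq.
  by case: s {IH} => [|l s]; rewrite /= ?addn0.
rewrite [lword _]/= /=.
by rewrite H take_size_cat ?size_nseq // all_nseq orbT drop_size_cat ?size_nseq // IH.
Qed.

Lemma leval_lmul (M : lmodType coef) (phi : seq nat -> M) L L' :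
  leval phi (lmul L L') = leval (fun s => leval (fun s' => phi (s ++ s')) L') L.
Proof.
rewrite /leval /lmul big_allpairs_dep; apply: eq_bigr => t _.
by rewrite scaler_sumr; apply: eq_bigr => s _; rewrite scalerA.
Qed.

Lemma emb_psi_letter k V : eact V (psi_sh_letter k) = plstep k V.
Proof.
rewrite /eact /psi_sh_letter big_map -[iota 0 k.+1]/(index_iota 0 k.+1) big_mkord /plstep.
have iQ U : iter k Qop U = \sum_(j < k.+1) (('C(k, j)%:R * hbar ^+ (k - j)) : coef) *: iter j Pop U.
  elim: k U => [|k IH] U; first by rewrite big_ord1 /= mulr1 scale1r.
  rewrite iterS IH [RHS]big_ord_recl /= bin0 mul1r subn0.
  under [in RHS]eq_bigr => j _ do rewrite /bump /= add1n binS natrD mulrDl scalerDl subSS.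
  rewrite big_split addrA addrC /Qop; congr (_ + _).
    rewrite linear_sum; apply: eq_bigr => j _; exact: linearZ.
  rewrite -hhE big_ord_recl /= bin0 mul1r subn0 scalerDr scalerA -exprS; congr (_ + _).
  rewrite [RHS]big_ord_recr /= bin_small // mul0r scale0r addr0 scaler_sumr.
  apply: eq_bigr => j _; rewrite scalerA /bump /= add1n; congr (_ *: _).
  by rewrite mulrCA -exprS subnSK.
rewrite iQ scaler_sumr; apply: eq_bigr => j _.
rewrite scalerA mulrA; congr (_ *: _).
by rewrite -[RHS]/(lact V [:: nat_of_ord j]) -act_lword /lword /= cats0.
Qed.

(** * Divisibility by powers of hbar *)

(* Words are read backwards, so a letter b is bare (b a^0) iff the letter a does not
   stand just before it in the list; the argument x tells whether the letter
   just before the list is an a. *)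
Fixpoint bare (x : bool) (w : word) : nat :=
  if w is c :: w' then ((~~ c && ~~ x) + bare c w')%N else 0%N.

Definition divs (x : bool) (f : hseries) := forall w, hbar ^+ bare x w %| f w.
Definition starts_b (f : hseries) := forall w, f (rcons w true) = 0.
Definition bounded (N : nat) (f : hseries) := forall w, (N < size w)%N -> f w = 0.

Lemma bare_le w : (bare true w <= bare false w <= (bare true w).+1)%N.
Proof.
by case: w => //= c w; rewrite andbT andbF add0n; case: c => /=; rewrite ?add0n ?add1n leqnn ?leqnSn.
Qed.

Lemma divs_weak f : divs false f -> divs true f.
Proof. by move=> Hf w; apply: dvdp_trans (Hf w); apply: dvdp_exp2l; case/andP: (bare_le w). Qed.
Lemma divs_hbar f : divs true f -> divs false (hbar *: f).
Proof.
move=> Hf w; apply: (@dvdp_trans _ (hbar ^+ (bare true w).+1)).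
  by apply: dvdp_exp2l; case/andP: (bare_le w).
by rewrite hsZ exprS dvdp_mul2l ?polyX_eq0.
Qed.
Lemma divsD x f g : divs x f -> divs x g -> divs x (f + g).
Proof. by move=> Hf Hg w; rewrite hsD dvdp_add. Qed.
Lemma divsZ x c f : divs x f -> divs x (c *: f).
Proof. by move=> Hf w; rewrite hsZ dvdp_mull. Qed.
Lemma divs_nob f : divs true f -> divs false (nob f).
Proof.
move=> Hf [|[] w]; rewrite /= ?dvdp0 //; first exact: (Hf [::]).
exact: (Hf (true :: w)).
Qed.
Lemma divs_a f : divs true f -> divs true (der true f).
Proof. by move=> Hf w; apply: (Hf (true :: w)). Qed.
Lemma divs_b f : divs true f -> divs false (der false f).
Proof. by move=> Hf w; apply: (Hf (false :: w)). Qed.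

(* The induction needs the weaker divisibility for der true f, which loses the last letter a. *)
Lemma divs_mul_ind w f g :
  (divs false f -> divs false g -> hbar ^+ bare false w %| (f * g) w) /\
  (divs true f -> divs false g -> hbar ^+ bare true w %| (f * g) w).
Proof.
change ((divs false f -> divs false g -> hbar ^+ bare false w %| shm w f g) /\
  (divs true f -> divs false g -> hbar ^+ bare true w %| shm w f g)).
have C w' (u v : hseries) : shm w' u v = shm w' v u.
  by rewrite -!/(shmul _ _ w') shmulC.
elim: w f g => [|x w IH] f g; first by split => Hf Hg; rewrite expr0 dvd1p.
have H1 p r : divs false p -> divs false r -> hbar ^+ bare false w %| shm w p r by case: (IH p r).
have H2 p r : divs true p -> divs false r -> hbar ^+ bare true w %| shm w p r by case: (IH p r).
have H2' p r : divs false p -> divs true r -> hbar ^+ bare true w %| shm w p r.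
  by move=> *; rewrite C; apply: H2.
(* A bare final b costs one factor hbar; the quotient satisfies the same condition, so hbar can be
   pulled out before the induction hypothesis is applied. *)
have bdiv f' : divs false f' -> exists2 u, divs false u & der false f' = hbar *: u.
  move=> Hf'; pose u (v : word) := der false f' v %/ hbar.
  have hu v : der false f' v = hbar * u v.
    rewrite mulrC divpK //; apply: dvdp_trans (Hf' (false :: v)).
    by rewrite /= add1n exprS dvdp_mulr.
  exists (u : hseries); last by apply/funext => v; apply: hu.
  move=> v; have := Hf' (false :: v); rewrite -/(der false f' v) hu /= add1n exprS.
  by rewrite dvdp_mul2l ?polyX_eq0.
case: x => /=.
  have a g' h : divs true g' -> divs true h -> divs false h ->
    hbar ^+ bare true w %| shm w (der true g') (nob h) by move=> *; apply: H2; [apply: divs_a | apply: divs_nob].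
  split=> Hf Hg.
    have [Hf' Hg'] := (divs_weak Hf, divs_weak Hg).
    rewrite !dvdp_add ?a //; first by rewrite C a.
    rewrite -shmZl H2' //; [exact/divs_hbar/divs_a | exact: divs_a].
  have Hg' := divs_weak Hg.
  rewrite !dvdp_add ?a //.
    by apply: H2'; [exact: divs_nob | exact: divs_a].
  rewrite -shmZl H2' //; [exact/divs_hbar/divs_a | exact: divs_a].
split=> Hf Hg.
  have [u Hu ->] := bdiv f Hf; have [v Hv ->] := bdiv g Hg.
  rewrite add1n exprS shmZl (C w (nob f)) shmZl -mulrDr dvdp_mul2l ?polyX_eq0 //.
  rewrite dvdp_add ?H1 //; exact/divs_nob/divs_weak.
rewrite add0n dvdp_add //; first by apply: H1 => //; apply: divs_b.
have [v Hv ->] := bdiv g Hg; rewrite C shmZl dvdp_mull // H1 //; exact: divs_nob.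
Qed.

Lemma divs_mul f g : divs false f -> divs false g -> divs false (f * g).
Proof. by move=> Hf Hg w; apply: (divs_mul_ind w f g).1. Qed.

Lemma starts_b_der x f : starts_b f -> starts_b (der x f).
Proof. by move=> Hf w; apply: (Hf (x :: w)). Qed.
Lemma starts_b_nob f : starts_b f -> starts_b (nob f).
Proof. by move=> Hf w; rewrite /nob; case: w => [|[] w] /=; [apply: (Hf [::]) | apply: (Hf (true :: w)) |]. Qed.

Lemma starts_b_mul f g : starts_b f -> starts_b g -> starts_b (f * g).
Proof.
move=> Hf Hg w; change (shm (rcons w true) f g = 0).
elim: w f g Hf Hg => [|x w IH] f g Hf Hg /=.
  have [f0 g0] := (Hf [::], Hg [::]); rewrite /= in f0 g0.
  by rewrite /der f0 g0 !mul0r !mulr0 !addr0.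
have [Hf' Hg'] := (starts_b_nob Hf, starts_b_nob Hg).
by case: x => /=; rewrite !IH ?mulr0 ?addr0 //; apply: starts_b_der.
Qed.

Lemma bounded_der N x f : bounded N.+1 f -> bounded N (der x f).
Proof. by move=> Hf w Nw; apply: Hf. Qed.
Lemma bounded_nob N f : bounded N f -> bounded N (nob f).
Proof. by move=> Hf [|[] w] Nw //=; apply: Hf. Qed.
Lemma bounded_mul N M f g : bounded N f -> bounded M g -> bounded (N + M) (f * g).
Proof.
move=> Hf Hg w Nw; change (shm w f g = 0).
have b0 x (h : hseries) : bounded 0 h -> der x h = 0.
  by move=> Hh; apply/funext => v; apply: Hh.
elim: w N M f g Hf Hg Nw => // x w IH [|N] [|M] f g Hf Hg Nw /=.
- by rewrite !b0 // !(shm0l, shm0r) mulr0 !addr0; case: (x).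
- rewrite !(b0 _ f) // !(shm0l, shm0r) mulr0 add0r !addr0.
  have F := IH _ _ _ (der x g) (bounded_nob Hf) (bounded_der _ Hg) Nw.
  by case: (x) F => /= ->; rewrite ?add0r ?addr0.
- rewrite !(b0 _ g) // !(shm0l, shm0r) mulr0 !addr0; rewrite addn0 in Nw.
  have F h (Hh : bounded 0 h) := IH N 0%N (der x f) h (bounded_der _ Hf) Hh.
  by case: (x) F => /= ->; rewrite ?addn0 //; apply: bounded_nob.
have a1 h := IH N M.+1 (der x f) h (bounded_der _ Hf).
have a2 h Hh := IH N.+1 M h (der x g) Hh (bounded_der _ Hg).
have a3 : shm w (der x f) (der x g) = 0.
  apply: (IH N M); [exact: bounded_der | exact: bounded_der |].
  by move: Nw; rewrite /= addSn addnS ltnS; apply: ltnW.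
move: Nw; rewrite /= addSn ltnS => Nw.
have N2 : (N.+1 + M < size w)%N by rewrite addSnnS.
have {}a1 h Hh := a1 h Hh Nw; have {}a2 h Hh := a2 h Hh N2.
have [bf bg] := (bounded_nob Hf, bounded_nob Hg).
by case: (x) a1 a2 a3 => /= a1 a2 a3; rewrite a1 // a2 // ?a3 ?mulr0 ?addr0.
Qed.

(** * The algebra C<A> *)

(* in_CA f: f is an element of C<A>.  good f: f is in C<A>^+ a, which lies in H^0. *)
Definition in_CA (f : hseries) := [/\ divs false f, starts_b f & exists N, bounded N f].
Definition in_CA0 (f : hseries) := in_CA f /\ f [::] = 0.
Definition good (f : hseries) := exists2 v, in_CA0 v & f = Pop v.
Definition good1 (f : hseries) := exists c v, in_CA0 v /\ f = c%:A + Pop v.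

Lemma CA_Z c f : in_CA f -> in_CA (c *: f).
Proof.
case=> df sf [N bf]; split; first exact: divsZ.
  by move=> w; rewrite hsZ sf mulr0.
by exists N => w Nw; rewrite hsZ bf ?mulr0.
Qed.
Lemma CA_D f g : in_CA f -> in_CA g -> in_CA (f + g).
Proof.
move=> [df sf [N bf]] [dg sg [M bg]]; split; first exact: divsD.
  by move=> w; rewrite hsD sf sg addr0.
exists (maxn N M) => w; rewrite gtn_max => /andP[Nw Mw].
by rewrite hsD bf ?bg ?addr0.
Qed.
Lemma CA_M f g : in_CA f -> in_CA g -> in_CA (f * g).
Proof.
move=> [df sf [N bf]] [dg sg [M bg]]; split; first exact: divs_mul.
  exact: starts_b_mul.
by exists (N + M)%N; apply: bounded_mul.
Qed.
Lemma CA_1 : in_CA 1.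
Proof.
split=> [[|x w]|[|x w]|] //=; rewrite ?expr0 ?dvd1p ?dvdp0 //.
by exists 0%N => -[].
Qed.
Lemma CA_0 : in_CA 0. Proof. by rewrite -(scale0r 1); apply: CA_Z CA_1. Qed.
Lemma CA_hh : in_CA hh. Proof. exact: CA_Z CA_1. Qed.
Lemma CA_X f n : in_CA f -> in_CA (f ^+ n).
Proof. by move=> Hf; elim: n => [|n IH]; rewrite ?exprS; [apply: CA_1 | apply: CA_M]. Qed.
Lemma CA_sum n (F : 'I_n -> hseries) : (forall i, in_CA (F i)) -> in_CA (\sum_i F i).
Proof. by move=> HF; elim/big_ind: _ => // [|f g]; [apply: CA_0 | apply: CA_D]. Qed.

Lemma CA_hb : in_CA hb.
Proof.
rewrite /hb -hhE; split.
- case=> [|[] [|x w]]; rewrite hsZ /= ?mulr0 ?dvdp0 // mulr1 add1n expr1; exact: dvdpp.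
- by case=> [|[] [|x w]]; rewrite hsZ /= ?mulr0.
- by exists 1%N => -[|[] [|x w]] //; rewrite hsZ /= mulr0.
Qed.

(** The last b of V b is bare, so V b need not lie in C<A>; appending a turns it into the letter
    g_1. *)
Lemma CA_Pb V : in_CA V -> in_CA (Pop (bb * V)).
Proof.
rewrite -Bop_mul => -[dV sV [N bV]]; split.
- by case=> [|[] [|[] w]]; rewrite /= ?dvdp0 // !add0n; apply: dV.
- by case=> [|[] [|[] w]] //=; apply: sV.
- by exists N.+2 => -[|[] [|[] w]] //= Nw; apply: bV.
Qed.

Lemma CA0_Z c f : in_CA0 f -> in_CA0 (c *: f).
Proof. by case=> Hf f0; split; [apply: CA_Z | rewrite hsZ f0 mulr0]. Qed.
Lemma CA0_D f g : in_CA0 f -> in_CA0 g -> in_CA0 (f + g).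
Proof. by case=> Hf f0 [Hg g0]; split; [apply: CA_D | rewrite hsD f0 g0 addr0]. Qed.
Lemma CA0_Ml f g : in_CA0 f -> in_CA g -> in_CA0 (f * g).
Proof.
case=> Hf f0 Hg; split; first exact: CA_M.
by rewrite -[LHS]/(f [::] * g [::]) f0 mul0r.
Qed.
Lemma CA0_Mr f g : in_CA f -> in_CA0 g -> in_CA0 (f * g).
Proof. by move=> Hf Hg; rewrite mulrC; apply: CA0_Ml. Qed.
Lemma CA0_0 : in_CA0 0. Proof. by split; first exact: CA_0. Qed.
Lemma CA0_sum n (F : 'I_n -> hseries) : (forall i, in_CA0 (F i)) -> in_CA0 (\sum_i F i).
Proof. by move=> HF; elim/big_ind: _ => // [|f g]; [apply: CA0_0 | apply: CA0_D]. Qed.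

Lemma CA0_P f : in_CA0 f -> in_CA0 (Pop f).
Proof.
move=> [[df sf [N bf]] f0]; split=> //; split.
- case=> [|[] w]; rewrite /= ?dvdp0 ?expr0 ?add0n //.
  by apply: dvdp_trans (df w); apply: dvdp_exp2l; case/andP: (bare_le w).
- by case=> [|[] w] //=; apply: sf.
- by exists N.+1 => -[|[] w] //= Nw; apply: bf.
Qed.
Lemma CA0_Q f : in_CA0 f -> in_CA0 (Qop f).
Proof. by move=> Hf; apply: CA0_D; [apply: CA0_P | apply: CA0_Mr => //; apply: CA_hh]. Qed.
Lemma CA0_Qb V : in_CA V -> in_CA0 (Qop (bb * V)).
Proof.
move=> HV; split=> //; last by rewrite /Qop hsD -[(hh * _) _]/(_ * _) -Bop_mul mulr0 addr0.
apply: CA_D; first exact: CA_Pb.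
by rewrite mulrA; apply: CA_M => //; apply: CA_hb.
Qed.

Lemma good_CA f : good f -> in_CA f.
Proof. by case=> v Hv ->; case: (CA0_P Hv). Qed.
Lemma good_good1 f : good f -> good1 f.
Proof. by case=> v Hv ->; exists 0, v; rewrite scale0r add0r. Qed.
Lemma good1_1 : good1 1.
Proof. by exists 1, 0; rewrite scale1r raddf0 addr0; split=> //; apply: CA0_0. Qed.
Lemma good1_CA f : good1 f -> in_CA f.
Proof.
move=> [c [v [Hv ->]]]; apply: CA_D; first exact: CA_Z CA_1.
by apply: good_CA; exists v.
Qed.
Lemma good_D f g : good f -> good g -> good (f + g).
Proof. by case=> v Hv -> [w Hw ->]; exists (v + w); rewrite ?raddfD //; apply: CA0_D. Qed.
Lemma good_Z c f : good f -> good (c *: f).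
Proof. by case=> v Hv ->; exists (c *: v); rewrite ?linearZ //; apply: CA0_Z. Qed.
Lemma good_0 : good 0.
Proof. by exists 0; rewrite ?raddf0 //; apply: CA0_0. Qed.
Lemma good1_D f g : good1 f -> good1 g -> good1 (f + g).
Proof.
case=> c [v [Hv ->]] [d [w [Hw ->]]]; exists (c + d), (v + w).
by rewrite raddfD scalerDl addrACA; split => //; apply: CA0_D.
Qed.
Lemma good1_Z c f : good1 f -> good1 (c *: f).
Proof.
case=> d [v [Hv ->]]; exists (c * d), (c *: v).
by rewrite linearZ scalerDr scalerA; split => //; apply: CA0_Z.
Qed.

Lemma CA_fct_hb c n : in_CA (c *: hb ^+ n).
Proof. by apply: CA_Z; apply: CA_X; apply: CA_hb. Qed.

Lemma CA_psM (f g : pser hseries) n :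
  (forall m, in_CA (f m)) -> (forall m, in_CA (g m)) -> in_CA ((f * g) n).
Proof. by move=> Hf Hg; rewrite psM; apply: CA_sum => i; apply: CA_M. Qed.
Lemma CA0_psM (f g : pser hseries) n :
  (forall m, in_CA0 (f m)) -> (forall m, in_CA (g m)) -> in_CA0 ((f * g) n).
Proof. by move=> Hf Hg; rewrite psM; apply: CA0_sum => i; apply: CA0_Ml. Qed.

Lemma CA_flip (f : pser hseries) n : in_CA (f n) -> in_CA (psflip f n).
Proof.
move=> Hf; rewrite /psflip -signr_odd; case: (odd n); rewrite ?expr0 ?expr1 ?mul1r //.
by rewrite mulN1r -scaleN1r; apply: CA_Z.
Qed.

Lemma CA_fsol n V : in_CA V -> in_CA (fsol n V).
Proof.
move=> HV; elim/ltn_ind: n => n IH; rewrite fsol_right; apply: CA_D.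
  by case: n {IH} => // _; apply: CA_0.
apply: CA_sum => k; rewrite -mulrA; apply: CA_Pb; apply: CA_M; first exact: CA_fct_hb.
by apply: IH; apply: sub_ord_lt.
Qed.

(* V E_(1^n), and the signed sum of its cuts: see lact_eones and cuts_eones. *)
Definition run (n : nat) (V : hseries) : hseries := (gam * fsolp V) n.
Definition runcut (n : nat) (V V' : hseries) : hseries := (fsolp V * psflip (fsolp V')) n.

Lemma CA_run n V : in_CA V -> in_CA (run n V).
Proof. by move=> HV; apply: CA_psM => m; [apply: CA_fct_hb | apply: CA_fsol]. Qed.

Lemma run_linear n : linear (run n).
Proof.
move=> c f g; rewrite /run -!lact_eones -levalZ -levalD; apply: eq_leval => s.
exact: lact_linear.
Qed.
Lemma runcut_linearl n V' : linear (runcut n ^~ V').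
Proof.
move=> c f g; rewrite /runcut -!cuts_eones -levalZ -levalD; apply: eq_leval => s.
exact: cuts_linearl.
Qed.
Lemma runcut_linearr n V : linear (runcut n V).
Proof.
move=> c f g; rewrite /runcut -!cuts_eones -levalZ -levalD; apply: eq_leval => s.
exact: cuts_linearr.
Qed.
Lemma sign_scale n (f : hseries) : (-1 : coef) ^+ n *: f = (-1) ^+ n * f.
Proof.
rewrite -(signr_odd coef) -(signr_odd hseries).
by case: (odd n); rewrite ?expr0 ?expr1 ?scale1r ?mul1r ?scaleN1r ?mulN1r.
Qed.
(** F'(x) F(-x) is F(x) F'(-x) evaluated at -x: the source of the sign of a run of ones under
    reversal. *)
Lemma runcutC n V V' : runcut n V' V = (-1 : coef) ^+ n *: runcut n V V'.
Proof.
rewrite /runcut; have -> : fsolp V' * psflip (fsolp V) = psflip (fsolp V * psflip (fsolp V')).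
  by rewrite psflipM psflipK mulrC.
by rewrite /psflip sign_scale.
Qed.

(** In [fsol_mul] each summand under P contains v or v', hence has no constant term. *)
Lemma runcut_good n V V' : good V -> good1 V' -> good (runcut n V V').
Proof.
case=> v Hv -> [c [v' [Hv' ->]]]; rewrite /runcut fsol_mul /psP.
have HV : in_CA (Pop v) by case: (CA0_P Hv).
have HV' : in_CA (c%:A + Pop v') by apply: good1_CA; exists c, v'.
set w := (X in Pop X); exists w => //; rewrite {}/w.
have E m : in_CA (eps m) by apply: CA_fct_hb.
have C u m : in_CA0 u -> in_CA0 (psC u m) by case: m => // *; apply: CA0_0.
rewrite !psD; apply: CA0_D; last first.
  by apply: C; rewrite -mulrA; apply: CA0_Mr; [exact: CA_hh | apply: CA0_Ml => //; case: Hv'].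
apply: CA0_D.
  apply: CA0_psM => m; first exact: C.
  by apply: CA_psM => j; apply: CA_flip => //; apply: CA_fsol.
apply: CA0_psM => // m; rewrite mulrC; apply: CA0_psM => j; first exact: C.
exact: CA_fsol.
Qed.

Lemma runcut_good1 n V : good1 V -> good1 (runcut n V 1).
Proof.
case=> c [v [Hv ->]]; rewrite runcut_linearl; apply: good1_D; last first.
  by apply: good_good1; apply: runcut_good; [exists v | exact: good1_1].
(* For V = V' = 1 the product is exp(x g_1) exp(-x g_1) = 1, so only n = 0 contributes. *)
apply: good1_Z; rewrite /runcut fsol1_flip; case: n => [|n]; first exact: good1_1.
exact/good_good1/good_0.
Qed.

(* V e_x = blk x V and V psi^sh(e_x) = (-1)^x blk' x V. *)
Definition blk (x : nat) (V : hseries) : hseries := iter x.-1 Pop (Qop (bb * V)).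
Definition blk' (x : nat) (V : hseries) : hseries := Pop (iter x.-1 Qop (bb * V)).

Lemma blk_good x V : (1 < x)%N -> in_CA V -> good (blk x V).
Proof.
case: x => [|[|x]] // _ HV; exists (iter x Pop (Qop (bb * V))) => //.
by elim: x => [|x IH]; [apply: CA0_Qb | apply: CA0_P].
Qed.
Lemma blk'_good x V : (1 < x)%N -> in_CA V -> good (blk' x V).
Proof.
case: x => [|[|x]] // _ HV; exists (iter x.+1 Qop (bb * V)) => //.
by rewrite iterSr; elim: x => [|x IH]; [apply: CA0_Qb | apply: CA0_Q].
Qed.

(** Both blocks start with Q(b V) and end with P; in between there are x - 2 operators, Q = P + hbar
    in one and P in the other. *)
Lemma blk_diff x V : (1 < x)%N -> in_CA V ->
  exists2 u, good u & blk' x V = hbar *: u + blk x V.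
Proof.
case: x => [|[|x]] // _ HV; rewrite /blk' /blk [_.-1]/= iterSr iterS.
set W := Qop _; have HW : in_CA0 W by apply: CA0_Qb.
suff [u Hu ->] : exists2 u, in_CA0 u & iter x Qop W = hbar *: u + iter x Pop W.
  by exists (Pop u); [exists u | rewrite linearP].
elim: x => [|x [u Hu E]]; first by exists 0; rewrite ?scaler0 ?add0r //; apply: CA0_0.
exists (Pop u + iter x Qop W).
  by apply: CA0_D; [apply: CA0_P | elim: x {E} => [|x IH] //=; apply: CA0_Q].
by rewrite !iterS {1}/Qop {1}E linearP scalerDr -hhE addrAC.
Qed.

(** * Reversal of w^{S,sh}(E_k) *)

Local Notation sg n := ((-1 : coef) ^+ n).

Lemma iterP_Q y U : iter y.+1 Pop U + hbar *: iter y Pop U = iter y Pop (Qop U).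
Proof. by elim: y => [|y IH]; [rewrite /= /Qop hhE | rewrite [RHS]iterS -IH addrC [in RHS]addrC linearP]. Qed.

Lemma lact_e x V : (0 < x)%N -> leval (lact V) (e_letters x) = blk x V.
Proof.
case: x => // x _; rewrite /leval !big_cons big_nil addr0 scale1r.
exact: iterP_Q.
Qed.

(** The image of hbar b a^(x-1) carries the opposite sign, and this turns one of the x factors a +
    hbar back into a. *)
Lemma pact_e x V : (0 < x)%N -> leval (pact V) (e_letters x) = sg x *: blk' x V.
Proof.
case: x => // x _; rewrite /leval !big_cons big_nil addr0 scale1r /= /plstep /blk' /=.
by rewrite exprS mulN1r !scaleNr scalerA [hbar * _]mulrC -scalerA hhE {1}/Qop scalerDr opprD addrNK.
Qed.

Lemma leval_pact_lmul V L L' :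
  leval (pact V) (lmul L L') = leval (pact (leval (pact V) L')) L.
Proof.
rewrite leval_lmul; apply: eq_leval => s.
by rewrite (leval_linear _ _ (pact_linear s)); apply: eq_leval => s'; rewrite /= pact_cat.
Qed.
Lemma leval_cuts_lmul V V' L L' (U := leval (lact V) L) (U' := leval (pact V') L') :
  leval (cuts V V') (lmul L L') = leval (cuts V U') L + leval (cuts U V') L' - U * U'.
Proof.
rewrite leval_lmul.
have E s : leval (fun s' => cuts V V' (s ++ s')) L' =
    cuts V U' s + leval (cuts (lact V s) V') L' - lact V s * U'.
  rewrite (leval_linear _ _ (cuts_linearr V s)).
  have ml : linear ( *%R (lact V s)) by move=> c f g; rewrite mulrDr scalerAr.
  rewrite (leval_linear _ _ ml) -levalD -[X in _ - X]scale1r -scaleNr -levalZ -levalD.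
  by apply: eq_leval => s'; rewrite cuts_cat scaleN1r.
rewrite (eq_leval _ E) levalD levalD; congr (_ + _ + _).
  rewrite /leval; under eq_bigr => t _ do rewrite scaler_sumr.
  rewrite exchange_big; apply: eq_bigr => s _.
  rewrite -/(leval _ _) /U (leval_linear _ _ (cuts_linearl V' s.2)) /leval scaler_sumr.
  by apply: eq_bigr => t _; rewrite !scalerA mulrC.
have ml : linear (fun u => - (u * U')) by move=> c f g; rewrite mulrDl opprD -scalerAl scalerN.
by rewrite (leval_linear _ _ ml).
Qed.

(* The action of E_k with e_x replaced by the operator B x; n ones are still to be read. *)
Fixpoint lactE (B : nat -> hseries -> hseries) (n : nat) (k : seq nat) (V : hseries) : hseries :=
  match k with
  | [::] => run n V
  | x :: k' => if x == 1%N then lactE B n.+1 k' V else lactE B 0 k' (B x (run n V))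
  end.

Lemma lactE_ones B m n V : lactE B m (nseq n 1%N) V = run (m + n) V.
Proof. by elim: n m => [|n IH] m /=; rewrite ?addn0 // IH addSnnS. Qed.
Lemma lactE_cat B n k x k' V : x != 1%N ->
  lactE B n (k ++ x :: k') V = lactE B 0 k' (B x (lactE B n k V)).
Proof.
move=> /negbTE x1; elim: k n V => [|y k IH] n V /=; first by rewrite x1.
by case: eqP => _; rewrite IH.
Qed.

(** psi^sh reverses the order of the factors and fixes each E_(1^n) up to sign, so psi^sh(E_k) acts
    like the reversed index; the n pending ones come last. *)
Definition ractE B n k V := lactE B 0 (rev k ++ nseq n 1%N) V.

Lemma ractE_one B n k V : ractE B n (1%N :: k) V = ractE B n.+1 k V.
Proof. by rewrite /ractE rev_cons cat_rcons. Qed.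
Lemma ractE_cons B n x k V : x != 1%N ->
  ractE B n (x :: k) V = run n (B x (ractE B 0 k V)).
Proof. by move=> x1; rewrite /ractE rev_cons cat_rcons lactE_cat // lactE_ones cats0. Qed.

Lemma run_Z n c V : run n (c *: V) = c *: run n V.
Proof. by have [_ ->] := linear0Z (run_linear n). Qed.

Lemma blk'_linear x : linear (blk' x).
Proof.
move=> c f g; rewrite /blk' mulrDr -scalerAr; elim: x.-1 => [|y IH] /=.
  by rewrite linearP.
have Q u v : Qop (c *: u + v) = c *: Qop u + Qop v by apply: linearP.
suff -> : iter y Qop (c *: (bb * f) + bb * g) = c *: iter y Qop (bb * f) + iter y Qop (bb * g).
  by rewrite Q linearP.
by elim: y {IH} => //= y ->; apply: Q.
Qed.

Lemma pact_E_letters n k V : all (fun x => 0 < x)%N k ->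
  leval (pact V) (E_letters n k) = sg (n + sumn k) *: ractE blk' n k V.
Proof.
elim: k n => [|x k IH] n /=; first by rewrite addn0 pact_eones sign_scale /ractE lactE_ones.
case/andP => x0 Hk; case: eqP => [->|/eqP x1]; first by rewrite IH // ractE_one addnA addn1.
rewrite !leval_pact_lmul pact_e // IH // pact_eones -sign_scale ractE_cons //.
have [_ Z] := linear0Z (blk'_linear x).
by rewrite Z scalerA -/(run n _) run_Z scalerA add0n -!exprD.
Qed.

(* The sum of the cuts of E_k, where e_x acts on the left of the cut by B x and on
   its right by +/- B' x. *)
Fixpoint cutsE (B B' : nat -> hseries -> hseries) n k V V' : hseries :=
  match k with
  | [::] => runcut n V V'
  | x :: k' =>
      if x == 1%N then cutsE B B' n.+1 k' V V'
      else sg (x + sumn k') *: runcut n V (B' x (ractE B' 0 k' V'))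
           + cutsE B B' 0 k' (B x (run n V)) V'
  end.

Lemma cuts_E_letters n k V V' : all (fun x => 0 < x)%N k ->
  leval (cuts V V') (E_letters n k) = cutsE blk blk' n k V V'.
Proof.
elim: k n V => [|x k IH] n V /=; first by rewrite cuts_eones.
case/andP => x0 Hk; case: eqP => [_|/eqP x1]; first exact: IH.
rewrite !leval_cuts_lmul !leval_pact_lmul !lact_e // IH // cuts_eones !pact_e // pact_E_letters //.
rewrite lact_eones -/(run n V) add0n.
(* [e_letters] has single letters only, so its cuts are the two ends; they cancel the two overlaps
   subtracted by [leval_cuts_lmul]. *)
have -> U U' : leval (cuts U U') (e_letters x) =
   U * leval (pact U') (e_letters x) + leval (lact U) (e_letters x) * U'.
  rewrite /leval !big_cons !big_nil /= !addr0 mulrDr mulrDl -!scalerAr -!scalerAl !scalerDr.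
  by rewrite addrACA.
rewrite lact_e // pact_e //.
have [_ Z] := linear0Z (blk'_linear x).
have [_ T] := linear0Z (runcut_linearr n V).
rewrite Z !scalerA -!exprD -/(runcut n V _) T.
set a := _ *: runcut _ _ _; set b := run n V * _; set c := blk x _ * _; set d := cutsE _ _ _ _ _ _.
by rewrite (addrAC b c d) addrK (addrC b d) addrA addrK.
Qed.

Lemma cutsE_cat B B' n k x k' V V' : x != 1%N ->
  cutsE B B' n (k ++ x :: k') V V' =
  sg (x + sumn k') *: cutsE B B' n k V (B' x (ractE B' 0 k' V'))
  + cutsE B B' 0 k' (B x (lactE B n k V)) V'.
Proof.
move=> x1; elim: k n V => [|y k IH] n V /=; first by rewrite (negbTE x1).
case: eqP => _; first exact: IH.
rewrite IH scalerDr addrA; congr (_ + _ + _).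
rewrite sumn_cat /= scalerA -exprD addnA addnC; congr (_ *: runcut n V (B' y _)).
by rewrite /ractE !cats0 rev_cat rev_cons cat_rcons lactE_cat.
Qed.

Lemma cutsE_ones B B' m n V V' : cutsE B B' m (nseq n 1%N) V V' = runcut (m + n) V V'.
Proof. by elim: n m => [|n IH] m /=; rewrite ?addn0 // IH addSnnS. Qed.

(** Reading k backwards swaps the two sides of every cut, hence [B] with [B'], with the sign from
    [runcutC]. This is exact; hbar enters only when [B] and [B'] are swapped back. *)
Lemma cutsE_rev B B' n k V V' :
  cutsE B B' 0 (rev k ++ nseq n 1%N) V' V = sg (n + sumn k) *: cutsE B' B n k V V'.
Proof.
elim: k n V => [|x k IH] n V; first by rewrite cutsE_ones /= addn0 runcutC.
rewrite rev_cons cat_rcons /=; case: eqP => [->|/eqP x1].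
  by rewrite -[1%N :: nseq n 1%N]/(nseq n.+1 1%N) IH addnA addn1.
rewrite cutsE_cat // sumn_nseq mul1n cutsE_ones add0n.
have := IH 0%N (B' x (run n V)); rewrite cats0 add0n => IH0.
rewrite /ractE rev_nseq cats0 lactE_ones add0n IH0.
rewrite runcutC scalerDr !scalerA -!exprD cats0.
rewrite addrC; congr (_ *: _ + _ *: _).
  by rewrite -addnA exprD addnn -mul2n exprM sqrrN expr1n expr1n mulr1.
by rewrite addnA (addnC n).
Qed.

Lemma emb_psi_sh s : emb (psi_sh s) = pact 1 s.
Proof.
elim: s => [|k s IH]; first by rewrite /emb /eact big_seq1 scale1r.
by rewrite /= emb_mul emb_psi_letter IH.
Qed.

Lemma cuts_sum V V' s :
  \sum_(i < (size s).+1) lact V (take i s) * pact V' (drop i s) = cuts V V' s.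
Proof.
elim: s V => [|k s IH] V; first by rewrite big_ord1.
by rewrite big_ord_recl /= -IH.
Qed.

Lemma emb_wS_sh_letters s : emb (wS_sh_letters s) = cuts 1 1 s.
Proof.
rewrite -cuts_sum emb_flatten big_map -[iota 0 _]/(index_iota 0 (size s).+1) big_mkord.
apply: eq_bigr => i _; rewrite emb_sh emb_psi_sh; congr (_ * _).
by rewrite /emb /eact big_seq1 scale1r act_lword.
Qed.

Lemma emb_wS_sh_eq x y : emb x = emb y -> emb (wS_sh x) = emb (wS_sh y).
Proof.
move=> xy; rewrite !emb_flatten !big_map.
pose h (w : word) (c : coef) :=
  if to_letters w is Some s then c *: emb (wS_sh_letters s) else 0.
have E z : \sum_(t <- z) emb match to_letters t.2 with
      | Some s => escale t.1 (wS_sh_letters s) | None => e0 end = \sum_(t <- z) h t.2 t.1.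
  apply: eq_bigr => t _; rewrite /h; case: to_letters => [s|]; first exact: emb_scale.
  by rewrite /emb /eact big_nil.
rewrite !E; apply: emb_functional => // w a b; rewrite /h.
by case: to_letters => [s|]; rewrite ?scalerDl ?addr0.
Qed.

Lemma emb_wS_sh L : emb (wS_sh (to_elt L)) = leval (cuts 1 1) L.
Proof.
rewrite emb_flatten !big_map; apply: eq_bigr => t _.
by rewrite to_letters_lword emb_scale emb_wS_sh_letters.
Qed.

Lemma emb_wS_sh_E k : all (fun x => 0 < x)%N k ->
  emb (wS_sh (E_idx k)) = cutsE blk blk' 0 k 1 1.
Proof. by move=> Hk; rewrite (emb_wS_sh_eq (emb_E_idx 0 k)) emb_wS_sh cuts_E_letters. Qed.

Lemma lactE_CA B n k V : (forall x U, (1 < x)%N -> in_CA U -> good (B x U)) ->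
  all (fun x => 0 < x)%N k -> in_CA V -> in_CA (lactE B n k V).
Proof.
move=> HB; elim: k n V => [|x k IH] n V /=; first by move=> _; apply: CA_run.
case/andP => x0 Hk HV; case: eqP => [_|/eqP x1]; first exact: IH.
apply: IH => //; apply: good_CA; apply: HB; last exact: CA_run.
by rewrite ltn_neqAle eq_sym x1.
Qed.

Lemma ractE_CA B n k V : (forall x U, (1 < x)%N -> in_CA U -> good (B x U)) ->
  all (fun x => 0 < x)%N k -> in_CA V -> in_CA (ractE B n k V).
Proof.
move=> HB Hk; apply: lactE_CA => //; rewrite all_cat all_rev Hk.
by apply/allP => x /nseqP[->].
Qed.

Lemma cutsE_good1 n k V : all (fun x => 0 < x)%N k -> good1 V ->
  good1 (cutsE blk blk' n k V 1).
Proof.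
elim: k n V => [|x k IH] n V /=; first by move=> _; apply: runcut_good1.
case/andP => x0 Hk HV; case: eqP => [_|/eqP x1]; first exact: IH.
have xgt1 : (1 < x)%N by rewrite ltn_neqAle eq_sym x1.
apply: good1_D; last first.
  by apply: IH => //; apply/good_good1/blk_good => //; apply/CA_run/good1_CA.
apply/good_good1/good_Z; rewrite runcutC; apply/good_Z/runcut_good => //.
apply: blk'_good => //; apply: ractE_CA => //; [exact: blk'_good | exact: CA_1].
Qed.

Lemma lactE_diff n k V u : all (fun x => 0 < x)%N k -> in_CA V -> in_CA u ->
  exists2 w, in_CA w & lactE blk' n k (hbar *: u + V) = hbar *: w + lactE blk n k V.
Proof.
elim: k n V u => [|x k IH] n V u /=.
  by move=> _ HV Hu; exists (run n u); [exact: CA_run | rewrite run_linear].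
case/andP => x0 Hk HV Hu; case: eqP => [_|/eqP x1]; first exact: IH.
have xgt1 : (1 < x)%N by rewrite ltn_neqAle eq_sym x1.
have [w Hw E] := blk_diff xgt1 (CA_run n HV).
rewrite run_linear blk'_linear E addrA -scalerDr; apply: IH => //.
  exact/good_CA/blk_good/CA_run.
by apply: CA_D; apply: good_CA => //; apply: blk'_good => //; apply: CA_run.
Qed.

(** The term hbar u carries the error of the blocks already read on the left of the cut, which makes
    the induction close. *)
Lemma cutsE_diff n k V u : all (fun x => 0 < x)%N k -> good1 V -> good u ->
  exists2 w, good w &
    cutsE blk' blk n k (hbar *: u + V) 1 = hbar *: w + cutsE blk blk' n k V 1.
Proof.
elim: k n V u => [|x k IH] n V u /=.
  move=> _ HV Hu; exists (runcut n u 1); last by rewrite runcut_linearl.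
  exact: runcut_good good1_1.
case/andP => x0 Hk HV Hu; case: eqP => [_|/eqP x1]; first exact: IH.
have xgt1 : (1 < x)%N by rewrite ltn_neqAle eq_sym x1.
have [HVC HuC] := (good1_CA HV, good_CA Hu).
have [v Hv Ev] : exists2 v, good v &
    blk x (ractE blk 0 k 1) = hbar *: v + blk' x (ractE blk' 0 k 1).
  have Hk' : all (fun x => 0 < x)%N (rev k ++ nseq 0 1%N) by rewrite cats0 all_rev.
  have [r Hr Er] := lactE_diff 0 Hk' CA_1 CA_0.
  have RC : in_CA (ractE blk 0 k 1) by apply: ractE_CA => //; [exact: blk_good | exact: CA_1].
  have [w Hw Ew] := blk_diff xgt1 RC.
  (* [w] is the error of replacing this block, [r] that of the blocks applied before it. The sign is
     negative because here [blk'] is turned into [blk]. *)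
  exists (- 1 *: (w + blk' x r)); last first.
    rewrite /ractE -[X in blk' x (lactE blk' 0 _ X)]add0r -{1}(scaler0 _ hbar) Er blk'_linear.
    rewrite Ew scaleN1r !hhE -/(ractE blk 0 k 1); ring.
  by apply/good_Z/good_D => //; apply: blk'_good.
have RC' : in_CA (ractE blk' 0 k 1) by apply: ractE_CA => //; [exact: blk'_good | exact: CA_1].
have HB' := blk'_good xgt1 RC'.
have [w1 Hw1 E1] := blk_diff xgt1 (CA_run n HVC).
have Hb1 := good_good1 (blk_good xgt1 (CA_run n HVC)).
have Hw' : good (blk' x (run n u) + w1).
  by apply: good_D => //; apply: blk'_good => //; apply: CA_run.
have [w2 Hw2 E2] := IH 0%N _ _ Hk Hb1 Hw'.
rewrite run_linear blk'_linear E1 addrA -scalerDr E2 Ev.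
rewrite runcut_linearr !runcut_linearl.
set s := (-1) ^+ _.
exists (s *: (runcut n (hbar *: u + V) v + runcut n u (blk' x (ractE blk' 0 k 1))) + w2).
  apply: good_D => //; apply: good_Z; apply: good_D.
    rewrite runcutC; apply/good_Z/runcut_good => //.
    by apply: good1_D => //; apply/good_good1/good_Z.
  by apply: runcut_good => //; apply: good_good1.
have [c sE] : exists c : hseries, forall X, s *: X = c * X.
  by exists s%:A => X; rewrite mulr_algl.
rewrite runcut_linearl !hhE !sE; ring.
Qed.

Theorem emb_wS_sh_rev k : all (fun x => 0 < x)%N k ->
  exists2 f, good f & emb (wS_sh (E_idx (rev k))) =
    hbar *: f + sg (sumn k) *: emb (wS_sh (E_idx k)).
Proof.
move=> Hk; rewrite !emb_wS_sh_E ?all_rev //.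
have := cutsE_rev blk blk' 0 k 1 1; rewrite cats0 => ->.
have [w Hw E] := cutsE_diff 0 Hk good1_1 good_0.
exists (sg (sumn k) *: w); first exact: good_Z.
by rewrite scaler0 add0r in E; rewrite add0n E scalerDr !scalerA mulrC.
Qed.

(** * Truncated sums and their limits *)

Section Evaluation.
Variables (R : realType) (q : R[i]).
Local Notation C := R[i].
Local Notation N := (@Normc.normc R).

Lemma evD c d : ev q (c + d) = ev q c + ev q d.
Proof. by rewrite /ev rmorphD hornerD. Qed.
Lemma evM c d : ev q (c * d) = ev q c * ev q d.
Proof. by rewrite /ev rmorphM hornerM. Qed.
Lemma ev1 : ev q 1 = 1.
Proof. by rewrite /ev rmorph1 hornerC. Qed.
Lemma ev_hbar : ev q hbar = 1 - q.
Proof. by rewrite /ev map_polyX hornerX. Qed.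
Lemma ev_sign n : ev q ((-1) ^+ n) = (-1) ^+ n.
Proof. by rewrite /ev rmorphXn rmorphN1 horner_exp hornerN hornerC. Qed.

Lemma ZqM_cat M x y : ZqM q M (x ++ y) = ZqM q M x + ZqM q M y.
Proof. exact: big_cat. Qed.
Lemma ZqM_flatten M xs : ZqM q M (flatten xs) = \sum_(x <- xs) ZqM q M x.
Proof. exact: big_flatten. Qed.
Lemma ZqM_scale M c x : ZqM q M (escale c x) = ev q c * ZqM q M x.
Proof.
rewrite /ZqM big_map mulr_sumr; apply: eq_bigr => t _ /=.
by case: to_letters => [s|]; rewrite ?mulr0 // evM mulrA.
Qed.

Lemma ZqM_emb M x y : emb x = emb y -> ZqM q M x = ZqM q M y.
Proof.
pose h (w : word) (c : coef) : C :=
  if to_letters w is Some s then ev q c * Zrev q (rev s) M else 0.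
apply: (emb_functional (h := h)) => w a b; rewrite /h.
by case: to_letters => [s|]; rewrite ?evD ?mulrDl ?addr0.
Qed.

Definition Zl M (x : lelt) : C := \sum_(p <- x) ev q p.1 * Zrev q p.2 M.

Lemma Zl_app_last M k x : Zl M (lapp_last k x) = \sum_(1 <= m < M) Fq q m k * Zl m x.
Proof.
rewrite /Zl big_map /=; under [RHS]eq_bigr => m _ do rewrite mulr_sumr.
rewrite exchange_big; apply: eq_bigr => p _.
by rewrite mulr_sumr; apply: eq_bigr => m _; rewrite mulrCA.
Qed.

Lemma mul_nested_sums (a b : nat -> C) M :
  (\sum_(1 <= m < M) a m) * (\sum_(1 <= m < M) b m) =
  \sum_(1 <= m < M) (a m * (\sum_(1 <= i < m) b i) + b m * (\sum_(1 <= i < m) a i) + a m * b m).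
Proof.
elim: M => [|[|M] IH]; first by rewrite !big_geq // mul0r.
  by rewrite !big_geq // mul0r.
by rewrite !(big_nat_recr M.+1) //= -IH; ring.
Qed.

(** The circle product of letters becomes the product of values at the same m. It covers k = 0
    because the letter b then has value 1, its factor hbar being kept in the coefficient. *)
Lemma FqD m k l : Fq q m (k + l) = Fq q m k * Fq q m l.
Proof. by rewrite /Fq mulnDl !exprD invfM mulrACA. Qed.

Lemma Zl_st_rev M u v : Zl M (st_rev u v) = Zrev q u M * Zrev q v M.
Proof.
elim: u v M => [|k u IHu] v M; first by rewrite /Zl big_seq1 ev1 mul1r.
elim: v M => [|l v IHv] M; first by rewrite /Zl big_seq1 ev1 mul1r mulr1.
rewrite [LHS]/Zl !big_cat -!/(Zl _ _) /= -/(Zl _ _) !Zl_app_last.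
rewrite mul_nested_sums -!big_split; apply: eq_bigr => m _ /=.
rewrite !IHu -[X in Zl m X]/(st_rev (k :: u) v) IHv FqD /=; ring.
Qed.

Lemma ZqM_st M s t : ZqM q M (st_letters s t) = Zrev q (rev s) M * Zrev q (rev t) M.
Proof.
rewrite -Zl_st_rev /ZqM /st_letters /to_elt !big_map; apply: eq_bigr => p _ /=.
by rewrite to_letters_lword revK.
Qed.

Lemma ZqM_wS_ast M k : ZqM q M (wS_ast (g_idx k)) =
  \sum_(i < (size k).+1) (-1) ^+ sumn (drop i k) * (Zrev q (rev (take i k)) M * Zrev q (drop i k) M).
Proof.
rewrite /wS_ast /= cats0 to_letters_lword ZqM_scale ev1 mul1r ZqM_flatten big_map.
rewrite -[iota 0 _]/(index_iota 0 (size k).+1) big_mkord; apply: eq_bigr => i _.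
rewrite ZqM_scale ZqM_st revK; congr (_ * _).
elim: (drop i k) => [|x s IH]; first by rewrite big_nil ev1.
by rewrite big_cons evM IH /sgn ev_sign exprD.
Qed.

Lemma ZqM_wS_ast_rev M k : ZqM q M (wS_ast (g_idx (rev k))) =
  (-1) ^+ sumn k * ZqM q M (wS_ast (g_idx k)).
Proof.
rewrite !ZqM_wS_ast size_rev (reindex_inj rev_ord_inj) mulr_sumr; apply: eq_bigr => i _ /=.
have ik : (i <= size k)%N by rewrite -ltnS.
rewrite subSS take_rev drop_rev subKn // revK sumn_rev.
have -> : sumn k = (sumn (take i k) + sumn (drop i k))%N by rewrite -sumn_cat cat_take_drop.
have E : (-1) ^+ sumn (drop i k) * (-1) ^+ sumn (drop i k) = 1 :> C by rewrite -expr2 sqrr_sign.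
by rewrite exprD -[in RHS]mulrA (mulrA ((-1) ^+ sumn (drop i k)) _ (_ * _)) E mul1r [X in _ * X]mulrC.
Qed.

Definition cvgCn (u : nat -> C) :=
  cvgn (fun n => complex.Re (u n)) /\ cvgn (fun n => complex.Im (u n)).

Lemma ReD (x y : C) : complex.Re (x + y) = complex.Re x + complex.Re y.
Proof. by case: x; case: y. Qed.
Lemma ImD (x y : C) : complex.Im (x + y) = complex.Im x + complex.Im y.
Proof. by case: x; case: y. Qed.
Lemma ReM (x y : C) : complex.Re (x * y) =
  complex.Re x * complex.Re y - complex.Im x * complex.Im y.
Proof. by case: x; case: y. Qed.
Lemma ImM (x y : C) : complex.Im (x * y) =
  complex.Re x * complex.Im y + complex.Im x * complex.Re y.
Proof. by case: x; case: y. Qed.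

Lemma limC_mulD (a : C) u v b : cvgCn u -> cvgCn v ->
  cvgCn (fun n => a * u n + b * v n) /\
  limC (fun n => a * u n + b * v n) = a * limC u + b * limC v.
Proof.
move=> [ru iu] [rv iv].
have cM (c : R) (w : nat -> R) : cvgn w -> (fun n => c * w n) @ \oo --> c * limn w.
  by move=> cw; apply: cvgMr => //; exact: cw.
pose wr n := complex.Re a * complex.Re (u n) - complex.Im a * complex.Im (u n)
   + (complex.Re b * complex.Re (v n) - complex.Im b * complex.Im (v n)).
pose wi n := complex.Re a * complex.Im (u n) + complex.Im a * complex.Re (u n)
   + (complex.Re b * complex.Im (v n) + complex.Im b * complex.Re (v n)).
have Er : (fun n => complex.Re (a * u n + b * v n)) = wr.
  by apply/funext => n; rewrite ReD !ReM.
have Ei : (fun n => complex.Im (a * u n + b * v n)) = wi.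
  by apply/funext => n; rewrite ImD !ImM.
have cr : wr @ \oo --> complex.Re (a * limC u + b * limC v).
  rewrite ReD !ReM; exact: (cvgD (cvgB (cM _ _ ru) (cM _ _ iu)) (cvgB (cM _ _ rv) (cM _ _ iv))).
have ci : wi @ \oo --> complex.Im (a * limC u + b * limC v).
  rewrite ImD !ImM; exact: (cvgD (cvgD (cM _ _ iu) (cM _ _ ru)) (cvgD (cM _ _ iv) (cM _ _ rv))).
rewrite /cvgCn {1}/limC Er Ei; split.
  by split; [apply: (cvgP _ cr) | apply: (cvgP _ ci)].
rewrite (cvg_lim _ cr) // (cvg_lim _ ci) //.
by case: (_ + _).
Qed.

Hypothesis hq1 : `|q| < 1.

Lemma normc_ge0 (z : C) : 0 <= N z.
Proof. by case: z => x y; apply: sqrtr_ge0. Qed.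
Lemma normc_1 : N 1 = 1. Proof. exact: Normc.normc1. Qed.
Lemma normc_0 : N 0 = 0. Proof. exact: Normc.normc0. Qed.
Lemma normcX (z : C) n : N (z ^+ n) = N z ^+ n.
Proof. by elim: n => [|n IH]; [exact: normc_1 | rewrite !exprS Normc.normcM IH]. Qed.
Lemma normc_q : N q < 1.
Proof. by have := hq1; rewrite normc_def ltcE /= eqxx; case: (q). Qed.
Lemma Re_normc (z : C) : `|complex.Re z| <= N z.
Proof. by case: z => x y /=; rewrite -sqrtr_sqr ler_wsqrtr // lerDl sqr_ge0. Qed.
Lemma Im_normc (z : C) : `|complex.Im z| <= N z.
Proof. by case: z => x y /=; rewrite -sqrtr_sqr ler_wsqrtr // lerDr sqr_ge0. Qed.
Lemma normc_sum n (f : nat -> C) : N (\sum_(1 <= m < n) f m) <= \sum_(1 <= m < n) N (f m).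
Proof.
elim/big_ind2: _ => // [|x u y v xu yv]; first by rewrite normc_0.
by apply: le_trans (le_normcD _ _) _; apply: lerD.
Qed.

Lemma qint_inv_le m : (0 < m)%N -> N (qint q m)^-1 <= N (1 - q) / (1 - N q).
Proof.
move=> m0; have r1 := normc_q; have r0 := normc_ge0 q.
rewrite /qint invfM invrK Normc.normcM Normc.normcV mulrC ler_wpM2l ?normc_ge0 //.
have h : 1 - N q <= N (1 - q ^+ m).
  have : N 1 <= N (1 - q ^+ m) + N (q ^+ m) by rewrite -{1}(subrK (q ^+ m) 1) le_normcD.
  rewrite normc_1 normcX.
  have : N q ^+ m <= N q by rewrite -[X in _ <= X]expr1 ler_wiXn2l // ltW.
  lra.
have p : 0 < 1 - N q by lra.
rewrite lef_pV2 // posrE //; lra.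
Qed.

Lemma Fq_le k : exists2 K, 0 <= K & forall m, (0 < m)%N -> N (Fq q m k) <= K * N q ^+ (k * m).
Proof.
exists ((N (1 - q) / (1 - N q)) ^+ k).
  rewrite exprn_ge0 // divr_ge0 ?normc_ge0 // subr_ge0 ltW //; exact: normc_q.
move=> m m0; rewrite /Fq Normc.normcM normcX mulrC -exprVn normcX.
rewrite ler_wpM2r ?exprn_ge0 ?normc_ge0 // lerXn2r ?nnegrE ?normc_ge0 ?qint_inv_le //.
by apply: le_trans (qint_inv_le m0); apply: normc_ge0.
Qed.

(** A letter b has value 1 at every m, so inner sums may grow like a power of M; any exponential
    rate p > 1 dominates them. *)
Lemma Zrev_le (p : R) rs : 1 < p ->
  exists2 K, 0 <= K & forall M, N (Zrev q rs M) <= K * p ^+ M.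
Proof.
move=> p1; have p0 : 0 <= p by lra.
have r1 := normc_q; have r0 := normc_ge0 q.
elim: rs => [|k rs [K K0 HK]].
  by exists 1 => // M; change (N 1 <= 1 * p ^+ M); rewrite normc_1 mul1r exprn_ege1 // ltW.
have [L L0 HL] := Fq_le k.
(* This constant D satisfies D p^M + L K p^M = D p^(M+1), which is the step of the induction. *)
have D0 : 0 <= L * K / (p - 1) by rewrite divr_ge0 ?mulr_ge0 //; lra.
exists (L * K / (p - 1)) => // M.
apply: le_trans (normc_sum _ _) _.
have step m : (0 < m)%N -> N (Fq q m k * Zrev q rs m) <= L * K * p ^+ m.
  move=> m0; rewrite Normc.normcM -mulrA ler_pM ?normc_ge0 //.
  apply: le_trans (HL _ m0) _; rewrite ler_piMr // exprn_ile1 // ltW //.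
elim: M => [|M IH].
  by rewrite big_geq // expr0 mulr1.
have [->|M0] := posnP M.
  by rewrite big_geq // mulr_ge0 ?exprn_ge0.
rewrite big_nat_recr //=; apply: le_trans (lerD IH (step M M0)) _.
have pn : p - 1 != 0 by rewrite subr_eq0 gt_eqF.
rewrite le_eqVlt; apply/orP; left; apply/eqP; rewrite exprS; field; exact: pn.
Qed.

Lemma cvg_Zrev k rs : (0 < k)%N -> cvgCn (fun M => Zrev q (k :: rs) M).
Proof.
move=> k0; have r1 := normc_q; have r0 := normc_ge0 q.
(* Chosen with p > 1 and p |q| < 1: the decay |q|^m of the outermost letter beats the growth p^m of
   the inner sum. *)
pose p := 2 / (1 + N q).
have p1 : 1 < p by rewrite /p ltr_pdivlMr; lra.
have pr : p * N q < 1 by rewrite /p mulrAC ltr_pdivrMr; lra.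
have [K K0 HK] := Zrev_le rs p1; have [L L0 HL] := Fq_le k.
pose f m := if m is 0 then 0 else Fq q m k * Zrev q rs m.
have E (g : C -> R) : g 0 = 0 -> {morph g : x y / x + y} ->
    (fun M => g (Zrev q (k :: rs) M)) = series (fun m => g (f m)).
  move=> g0 gD; apply/funext => -[|M]; rewrite /series /=.
    by rewrite !big_geq.
  by rewrite [RHS]big_nat_recl // (_ : g (f 0%N) = 0) // add0r (big_morph g gD g0) big_add1.
have bound m : N (f m) <= geometric (L * K) (p * N q) m.
  case: m => [|m]; first by rewrite [f 0%N]/(0 : C) normc_0 /= mulr1 mulr_ge0.
  rewrite /f /geometric /=.
  have -> : L * K * (p * N q) ^+ m.+1 = L * N q ^+ m.+1 * (K * p ^+ m.+1).
    by rewrite exprMn; ring.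
  rewrite Normc.normcM ler_pM ?normc_ge0 //.
  apply: le_trans (HL m.+1 isT) _; apply: ler_wpM2l => //.
  by apply: ler_wiXn2l => //; [exact: ltW | rewrite leq_pmull].
have main (g : C -> R) : g 0 = 0 -> {morph g : x y / x + y} -> (forall z, `|g z| <= N z) ->
    cvgn (fun M => g (Zrev q (k :: rs) M)).
  move=> g0 gD gN; rewrite E //; apply: normed_cvg.
  have p0 : 0 <= p * N q by rewrite mulr_ge0 //; lra.
  apply: (@series_le_cvg _ _ (geometric (L * K) (p * N q))) => [n|n|n|] //=.
  - by apply: mulr_ge0; [apply: mulr_ge0 | apply: exprn_ge0].
  - exact: le_trans (gN _) (bound n).
  - by apply: is_cvg_geometric_series; rewrite ger0_norm.
split.
  by apply: main; [| exact: ReD | exact: Re_normc].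
by apply: main; [| exact: ImD | exact: Im_normc].
Qed.
End Evaluation.

(** * Elements of H^0 and the theorem *)

Lemma lword_rcons s k : lword (rcons s k) = lword s ++ bak k.
Proof. by rewrite -cats1 lword_cat /lword /= cats0. Qed.

Lemma rev_lword_rcons s k : rev (lword (rcons s k)) = nseq k true ++ false :: rev (lword s).
Proof. by rewrite lword_rcons rev_cat /bak rev_cons rev_nseq cat_rcons. Qed.

Lemma rev_lword_surj u : (forall u0, u <> rcons u0 true) -> exists s, u = rev (lword s).
Proof.
elim: u => [|x u IH] Hu; first by exists [::].
have [u0 E|s E] := IH; first by apply: (Hu (x :: u0)); rewrite E.
case: x Hu => Hu; last by exists (rcons s 0%N); rewrite rev_lword_rcons E.
case/lastP: s E => [|s k] E; first by case: (Hu [::]); rewrite E.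
by exists (rcons s k.+1); rewrite E !rev_lword_rcons.
Qed.

Lemma bare_rev_lword s : bare false (rev (lword s)) = count (pred1 0%N) s.
Proof.
elim/last_ind: s => // s k IH; rewrite rev_lword_rcons -cats1 count_cat /= addn0 -IH.
case: k => [|k] /=; first by rewrite addnC.
rewrite add0n addn0 -[RHS]add0n.
by elim: k => //= k IHk; rewrite add0n.
Qed.

Definition convergent_words (x : elt) :=
  forall t, t \in x -> t.2 = [::] \/ exists s k, t.2 = lword (rcons s k.+1).

Definition H0_series (f : hseries) :=
  exists x, [/\ cspan gen_H0 x, convergent_words x & emb x = f].
Definition admissible_series (f : hseries) := exists2 x, convergent_words x & emb x = f.

Lemma H0_series_0 : H0_series 0.
Proof.
exists [::]; split=> //; last by rewrite /emb /eact big_nil.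
by exists [::].
Qed.

Lemma H0_series_D f g : H0_series f -> H0_series g -> H0_series (f + g).
Proof.
move=> [x [[l [Hl El]] Cx <-]] [y [[m [Hm Em]] Cy <-]]; exists (x ++ y); split.
- exists (l ++ m); split; last by rewrite map_cat flatten_cat El Em.
  by move=> p; rewrite mem_cat => /orP[/Hl|/Hm].
- by move=> t; rewrite mem_cat => /orP[/Cx|/Cy].
- exact: emb_cat.
Qed.

(** A word ending with g_(k+1), k >= 1, is a generator of H^0 as it stands; one ending with g_1
    needs an extra hbar, which puts it into hbar times the span of [gen_H0hat]. *)
Lemma H0_series_word c s k :
  H0_series ((c * hbar ^+ ((k == 0%N) + count (pred1 0%N) s)) *: act 1 (lword (rcons s k.+1))).
Proof.
pose A := Aword (rcons s k.+1).
have EA : emb A = hbar ^+ count (pred1 0%N) s *: act 1 (lword (rcons s k.+1)).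
  by rewrite /emb /eact big_seq1 /= -cats1 count_cat /= !addn0.
pose G := if k == 0%N then escale hbar A else A.
exists (escale c G); split.
- exists [:: (c, G)]; split; last by rewrite /= cats0.
  move=> p; rewrite inE => /eqP -> /=; rewrite /G /gen_H0; case: eqP => [k0|k0].
    right; right; exists A => //; right; exists s, k.+1; by split.
  by left; right; exists s, k.+1; split => //; rewrite ltnS lt0n; apply/eqP.
- move=> t; rewrite /G; case: eqP => _; rewrite !inE => /eqP -> /=; right; by exists s, k.
- rewrite /G emb_scale; case: eqP => _; rewrite ?emb_scale EA !scalerA ?add0n //.
  by rewrite add1n exprS mulrA.
Qed.

Fixpoint words (n : nat) : seq word :=
  if n is m.+1 then [::] :: flatten [seq [:: true :: w; false :: w] | w <- words m] else [:: [::]].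

Lemma mem_words n w : (size w <= n)%N -> w \in words n.
Proof.
elim: n w => [|n IH] [|x w] //= wn; rewrite inE /=; apply/flattenP.
exists [:: true :: w; false :: w]; first by apply: map_f; apply: IH.
by case: x; rewrite !inE eqxx ?orbT.
Qed.

Lemma bounded_sum N f : bounded N f ->
  f = \sum_(w <- undup (words N)) f w *: act 1 (rev w).
Proof.
move=> bf; apply/funext => v.
have E (r : seq word) : (\sum_(w <- r) f w *: act 1 (rev w)) v = \sum_(w <- r) f w * (v == w)%:R.
  elim: r => [|w r IH]; first by rewrite !big_nil.
  by rewrite !big_cons hsD IH hsZ act1E revK.
rewrite E; have [vN|Nv] := leqP (size v) N; last first.
  rewrite bf // big1_seq // => w _; case: eqP => [<-|_]; rewrite ?mulr0 //.
  by rewrite bf // mul0r.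
rewrite (bigD1_seq v) ?undup_uniq ?mem_undup ?mem_words //= eqxx mulr1 big1 ?addr0 // => w wv.
by rewrite eq_sym (negbTE wv) mulr0.
Qed.

(** Appending a maps g_k to g_(k+1) and hbar b to hbar g_1; in the second case the hbar of the bare
    b is exactly the extra factor that a final g_1 requires. *)
Lemma good_H0 f : good f -> H0_series f.
Proof.
case=> v Hv ->; have [[_ _ [N bP]] _] := CA0_P Hv; case: Hv => -[dv sv _] v0.
rewrite (bounded_sum bP); elim/big_ind: _ => [||w _]; [exact: H0_series_0 | exact: H0_series_D |].
case: w => [|[] w]; rewrite /= ?scale0r; try exact: H0_series_0.
have [->|vw] := eqVneq (v w) 0; first by rewrite scale0r; apply: H0_series_0.
have [s E] : exists s, w = rev (lword s).
  by apply: rev_lword_surj => u Eu; move: vw; rewrite Eu sv eqxx.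
case/lastP: s E => [|s k] E; first by move: vw; rewrite E /= v0 eqxx.
have := dv w; rewrite {1}E bare_rev_lword -cats1 count_cat /= addn0 => /dvdpP[c ->].
have -> : rev (true :: w) = lword (rcons s k.+1).
  by rewrite -[RHS]revK rev_lword_rcons E rev_lword_rcons.
rewrite addnC; exact: H0_series_word.
Qed.

Lemma good1_admissible f : good1 f -> admissible_series f.
Proof.
case=> c [v [Hv ->]]; have [|x [_ Cx Ex]] := @good_H0 (Pop v); first by exists v.
exists ((c, [::]) :: x); last first.
  by rewrite -cat1s emb_cat Ex; congr (_ + _); rewrite /emb /eact big_seq1.
by move=> t; rewrite inE => /orP[/eqP ->|/Cx]; first by left.
Qed.

Section Limits.
Variables (R : realType) (q : R[i]).
Hypothesis hq1 : `|q| < 1.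

Lemma cvg_ZqM x : convergent_words x -> cvgCn (fun M => ZqM q M x).
Proof.
elim: x => [|t x IH] Cx.
  have -> : (fun M => ZqM q M [::]) = fun=> 0 by apply/funext => M; rewrite /ZqM big_nil.
  by split; apply: is_cvg_cst.
have [|c1 _] := IH; first by move=> u ux; apply: Cx; rewrite inE ux orbT.
have cw : cvgCn (fun M => match to_letters t.2 with
                | Some s => Zrev q (rev s) M | None => 0 end).
  have [->|[s [k ->]]] := Cx t (mem_head _ _).
    by split; apply: is_cvg_cst.
  rewrite to_letters_lword rev_rcons; exact: cvg_Zrev.
have [] := limC_mulD (ev q t.1) 1 cw (IH _).
  by move=> u ux; apply: Cx; rewrite inE ux orbT.
rewrite (_ : (fun n => _) = (fun M => ZqM q M (t :: x))) //.
apply/funext => M; rewrite /ZqM big_cons mul1r.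
by case: to_letters => [s|] //; rewrite mulr0.
Qed.

Lemma cvg_ZqM_good1 x : good1 (emb x) -> cvgCn (fun M => ZqM q M x).
Proof.
case/good1_admissible => y /cvg_ZqM cy Exy.
by rewrite (_ : (fun M => _) = (fun M => ZqM q M y)) //; apply/funext => M; apply: ZqM_emb.
Qed.

Lemma Zq_nil : Zq q [::] = 0.
Proof.
rewrite /Zq (_ : (fun M => ZqM q M [::]) = fun=> 0); last first.
  by apply/funext => M; rewrite /ZqM big_nil.
have l0 : limn (fun=> 0 : R) = 0 by apply: cvg_lim => //; apply: cvg_cst.
by rewrite /limC /= l0.
Qed.

(** [limn] of a divergent sequence is the default value 0, which is its own negative, so the sign
    passes through in every case. *)
Lemma limC_sign n (u : nat -> R[i]) : limC (fun M => (-1) ^+ n * u M) = (-1) ^+ n * limC u.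
Proof.
rewrite -signr_odd; case: (odd n); last first.
  by rewrite expr0 mul1r; congr limC; apply/funext => M; rewrite mul1r.
have limN_total (v : nat -> R) : limn (fun n => - v n) = - limn v.
  have [cv|ncv] := pselect (cvgn v); first by apply: cvg_lim => //; apply: cvgN.
  have ncv' : ~ cvgn (- v) by rewrite is_cvgNE.
  by rewrite (dvgP ncv) -[LHS]/(limn (- v)) (dvgP ncv') oppr0.
rewrite expr1 mulN1r /limC.
rewrite (_ : (fun M => complex.Re (-1 * u M)) = fun M => - complex.Re (u M)); last first.
  by apply/funext => M; rewrite mulN1r; case: (u M).
rewrite (_ : (fun M => complex.Im (-1 * u M)) = fun M => - complex.Im (u M)); last first.
  by apply/funext => M; rewrite mulN1r; case: (u M).
by rewrite !limN_total.
Qed.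
End Limits.

Unset Implicit Arguments.
Set Strict Implicit.
Theorem theorem6p1 (R : realType) (q : R[i])
    (hq0 : 0 < `|q|) (hq1 : `|q| < 1) (k : seq nat) (hk : all (fun x => 0 < x)%N k) :
  (* Z_q^{S,*}(g_{rev k}) = (-1)^wt(k) Z_q^{S,*}(g_k) *)
  ZqS_ast q (g_idx (rev k)) = (-1) ^+ wt k * ZqS_ast q (g_idx k)
  /\
  (* Z_q^{S,sh}(E_{rev k}) = (-1)^wt(k) Z_q^{S,sh}(E_k)  mod (1-q) Z_q *)
  (exists z, Zset_q q z /\
     ZqS_sh q (E_idx (rev k)) - (-1) ^+ wt k * ZqS_sh q (E_idx k) = (1 - q) * z)
  /\
  (* zeta_q^S(rev k) = (-1)^wt(k) zeta_q^S(k)  in  Z_q / (N_q + P_q) *)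
  (exists n p, Nset_q q n /\ Pset_q q p /\
     ZqS_ast q (g_idx (rev k)) - (-1) ^+ wt k * ZqS_ast q (g_idx k) = n + p).
Proof.
have ast : ZqS_ast q (g_idx (rev k)) = (-1) ^+ wt k * ZqS_ast q (g_idx k).
  rewrite /ZqS_ast /Zq -limC_sign; congr limC; apply/funext => M.
  exact: ZqM_wS_ast_rev.
split=> //; split; last first.
  (* The star identity is exact, so both ideals contribute 0, the empty combination. *)
  exists 0, 0; split; first by exists [::]; [by exists [::] | exact: Zq_nil].
  by split; [exists [::]; rewrite big_nil | rewrite ast subrr addr0].
have [f Hf Ef] := emb_wS_sh_rev hk; have [x [Sx Cx Ex]] := good_H0 Hf.
exists (Zq q x); split; first by exists x.
(* Splitting the limit of (1 - q) x plus the signed sum requires convergence of both parts; here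
   [good1] provides it. *)
have cE : cvgCn (fun M => ZqM q M (wS_sh (E_idx k))).
  apply: cvg_ZqM_good1 => //; rewrite emb_wS_sh_E //; apply: cutsE_good1 => //; exact: good1_1.
have [_ L] := limC_mulD (1 - q) ((-1) ^+ wt k) (cvg_ZqM hq1 Cx) cE.
rewrite /ZqS_sh {1}/Zq (_ : (fun M => ZqM q M (wS_sh (E_idx (rev k)))) =
  fun n => (1 - q) * ZqM q n x + (-1) ^+ wt k * ZqM q n (wS_sh (E_idx k))).
  by rewrite L addrK.
apply/funext => M.
rewrite -(ev_hbar q) -(ev_sign q) -!ZqM_scale -ZqM_cat; apply: ZqM_emb.
by rewrite Ef emb_cat !emb_scale Ex.
Qed.
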